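(* For a compact topological Hausdorff space $(X,\tau)$ the following statements are equivalent: (i) There exists a universal kernel $k$ on $X$. (ii) There exists a continuous characteristic kernel $k$ on $X$. (iii) $X$ is metrizable, i.e. there exists a metric generating the topology $\tau$. If one, and thus all, statements are true, $(X,\tau)$ is a compact Polish space and $\mathcal M^*(X)=\mathcal M(X)$.
   Context: A kernel on $X$ is a symmetric positive definite function $k:X\times X\to\mathbb R$ (i.e. $\sum_{i,j}a_ia_jk(x_i,x_j)\ge0$ for all finite choices). On a compact Hausdorff space $X$, a continuous kernel $k$ with reproducing kernel Hilbert space $H$ (so that $H\subset C(X)$) is universal if $H$ is dense in $C(X)$ with respect to the supremum norm. $\mathcal M(X)$ is the space of finite signed measures on the Borel $\sigma$-algebra $\mathcal B(X)$, $\mathcal M_1(X)$ the set of Borel probability measures. $\mathcal M^*(X)$ is the space of finite signed Radon measures, i.e. differences of two finite measures $\nu$ on $\mathcal B(X)$ satisfying $\nu(B)=\sup\{\nu(K):K\text{ compact},K\subset B\}=\inf\{\nu(O):O\text{ open},B\subset O\}$ for all $B\in\mathcal B(X)$. A bounded measurable kernel $k$ is characteristic if the kernel mean embedding $\mathcal M_1(X)\to H$, $P\mapsto\int_Xk(\cdot,x)\,\mathrm dP(x)$ (Pettis integral), is injective. *)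

(* Defs.v *)
From HB Require Import structures.
From mathcomp Require Import all_boot all_order all_algebra.
From mathcomp Require Import all_classical all_reals all_analysis.
Set Implicit Arguments.
Unset Strict Implicit.
Unset Printing Implicit Defensive.
Import Order.TTheory GRing.Theory Num.Theory.
Import numFieldNormedType.Exports.
Local Open Scope classical_set_scope.
Local Open Scope ring_scope.

(* A [measurableType] carries a distinguished point.  To keep the empty space
   in scope, [X] is not assumed pointed: its Borel space is built from a point
   [x0 : X], and Borel notions are then quantified over [x0].  Neither the
   Borel sets nor measures and integrals depend on the choice of [x0]. *)
Definition pointed_at (X : topologicalType) (x0 : X) : Type := X.
HB.instance Definition _ (X : topologicalType) (x0 : X) :=
  Choice.on (pointed_at x0).
HB.instance Definition _ (X : topologicalType) (x0 : X) :=
  isPointed.Build (pointed_at x0) x0.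

Definition open_sets (X : topologicalType) (x0 : X) :
  set (set (pointed_at x0)) := @open X.
Arguments open_sets {X} x0 _.

Notation borel x0 := (g_sigma_algebraType (open_sets x0)).

Section Kernels.
Variables (R : realType) (X : topologicalType).
Implicit Types (k : X -> X -> R) (f g h : X -> R).

Definition is_kernel k :=
  (forall x y, k x y = k y x) /\
  (forall (n : nat) (a : 'I_n -> R) (x : 'I_n -> X),
     0 <= \sum_(i < n) \sum_(j < n) a i * a j * k (x i) (x j)).

Definition continuous_kernel k := continuous (fun z : X * X => k z.1 z.2).

(* [H] with the inner product [ip] (only meaningful on [H]) is a Hilbert space
   of real functions on [X]. *)
Record hilbert_function_space (H : set (X -> R))
    (ip : (X -> R) -> (X -> R) -> R) : Prop := HilbertFunctionSpace {
  hfs_zero : H 0;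
  hfs_lin : forall (a : R) f g, H f -> H g -> H (a *: f + g);
  hfs_ipC : forall f g, H f -> H g -> ip f g = ip g f;
  hfs_ip_lin : forall (a : R) f g h, H f -> H g -> H h ->
    ip (a *: f + g) h = a * ip f h + ip g h;
  hfs_ip_ge0 : forall f, H f -> 0 <= ip f f;
  hfs_ip_eq0 : forall f, H f -> ip f f = 0 -> f = 0;
  hfs_complete : forall u : nat -> X -> R, (forall n, H (u n)) ->
    (forall e : R, 0 < e -> exists N : nat, forall m n : nat,
       (N <= m)%N -> (N <= n)%N -> Num.sqrt (ip (u m - u n) (u m - u n)) < e) ->
    exists2 f, H f & forall e : R, 0 < e -> exists N : nat, forall n : nat,
       (N <= n)%N -> Num.sqrt (ip (u n - f) (u n - f)) < e
}.

(* By the Moore-Aronszajn theorem every kernel has exactly one RKHS, so it does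
   not matter below whether an RKHS is quantified existentially or
   universally. *)
Record is_rkhs k (H : set (X -> R)) (ip : (X -> R) -> (X -> R) -> R) : Prop :=
  IsRKHS {
  rkhs_hilbert : hilbert_function_space H ip;
  rkhs_kernel : forall x, H (k ^~ x);
  rkhs_reproducing : forall f x, H f -> f x = ip f (k ^~ x)
}.

Definition sup_norm f : R := sup (range (fun x => `|f x|)).

Definition universal k :=
  continuous_kernel k /\
  exists H ip, [/\ is_rkhs k H ip,
    forall h, H h -> continuous h &
    forall f, continuous f -> forall e : R, 0 < e ->
      exists2 h, H h & sup_norm (f - h) < e].

Definition bounded_linear_functional (H : set (X -> R))
    (ip : (X -> R) -> (X -> R) -> R) (phi : (X -> R) -> R) :=
  (forall (a : R) f g, H f -> H g -> phi (a *: f + g) = a * phi f + phi g) /\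
  (exists C : R, forall f, H f -> `|phi f| <= C * Num.sqrt (ip f f)).

Definition is_pettis_integral (H : set (X -> R))
    (ip : (X -> R) -> (X -> R) -> R) (x0 : X) (P : probability (borel x0) R)
    (F : X -> X -> R) h :=
  H h /\
  forall phi, bounded_linear_functional H ip phi ->
    P.-integrable setT (fun x : borel x0 => (phi (F x))%:E) /\
    (\int[P]_(x in setT) (phi (F x))%:E)%E = (phi h)%:E.

(* Measures are functions on all subsets, with no constraint outside of the
   sigma-algebra: their equality is equality on measurable sets. *)
Definition characteristic k (x0 : X) :=
  [/\ exists M : R, forall x y, `|k x y| <= M,
      measurable_fun setT (fun z : borel x0 * borel x0 => k z.1 z.2) &
      exists H ip (Phi : probability (borel x0) R -> X -> R),
        [/\ is_rkhs k H ip,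
            forall P, is_pettis_integral H ip P (fun x => k ^~ x) (Phi P) &
            forall P Q, Phi P = Phi Q ->
              forall A : set (borel x0), measurable A -> P A = Q A]].

Record is_metric (d : X -> X -> R) : Prop := IsMetric {
  metric_ge0 : forall x y, 0 <= d x y;
  metric_eq0 : forall x y, d x y = 0 <-> x = y;
  metric_sym : forall x y, d x y = d y x;
  metric_triangle : forall x y z, d x z <= d x y + d y z
}.

Definition generates_topology (d : X -> X -> R) :=
  forall A : set X, open A <->
    forall x, A x -> exists2 e : R, 0 < e & [set y | d x y < e] `<=` A.

Definition metrizable :=
  exists d : X -> X -> R, is_metric d /\ generates_topology d.

Definition complete_metric (d : X -> X -> R) :=
  forall u : nat -> X,
    (forall e : R, 0 < e -> exists N : nat, forall m n : nat,
       (N <= m)%N -> (N <= n)%N -> d (u m) (u n) < e) ->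
    exists x, forall e : R, 0 < e -> exists N : nat, forall n : nat,
       (N <= n)%N -> d (u n) x < e.

Definition polish :=
  (exists D : set X, countable D /\ dense D) /\
  exists d : X -> X -> R,
    [/\ is_metric d, generates_topology d & complete_metric d].

Definition radon (x0 : X) (nu : {finite_measure set (borel x0) -> \bar R}) :=
  forall B : set (borel x0), measurable B ->
    nu B = ereal_sup [set nu K | K in [set K : set X | compact K /\ K `<=` B]] /\
    nu B = ereal_inf [set nu O | O in [set O : set X | open O /\ B `<=` O]].

Definition signed_radon_measures (x0 : X) :
    set (charge (borel x0) R) :=
  [set nu | exists nu1 nu2 : {finite_measure set (borel x0) -> \bar R},
     [/\ radon nu1, radon nu2 &
         forall B, measurable B -> nu B = (nu1 B - nu2 B)%E]].

Definition signed_measures (x0 : X) : set (charge (borel x0) R) :=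
  setT.

End Kernels.

Arguments signed_radon_measures R {X} x0 _.
Arguments signed_measures R {X} x0 _.

(* Main.v *)
(** A universal or characteristic continuous kernel k separates points through
    its canonical feature map, so d(x, y) = |k(., x) - k(., y)| is a continuous
    metric on X, and a continuous metric on a compact space generates the
    topology; in the characteristic case separation is tested on Dirac measures.

    Conversely, on a compact metric space partitions of unity subordinate to
    finite nets give a sequence of continuous functions with dense span.
    Gaussian elimination, with suitable scaling, turns it into functions e_m
    with |e_m| <= 2^-(m+1) such that every nonzero e_m has a point where it does
    not vanish while all later e_j do.  This triangular shape makes the
    coefficients a of f = sum_m a_m e_m unique, so the functions with
    square-summable coefficients form a Hilbert space with kernel
    k(x, y) = sum_m e_m(x) e_m(y), and this space is dense in C(X).  The mean
    embedding of P has coefficients (int e_m dP)_m, which determine int f dP for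
    continuous f, hence P by Urysohn's lemma and the regularity of finite Borel
    measures on a compact metric space.  The same regularity, with the Jordan
    decomposition, shows that all finite signed measures are Radon. *)

Require Import Defs.
From mathcomp Require Import all_boot all_order all_algebra.
From mathcomp Require Import all_classical all_reals all_analysis.
From mathcomp Require Import measurable_realfun ring lra.
Import Order.TTheory GRing.Theory Num.Theory.
Import numFieldNormedType.Exports.
Local Open Scope classical_set_scope.
Local Open Scope ring_scope.
Set Implicit Arguments.
Unset Strict Implicit.
Unset Printing Implicit Defensive.

(** * Square-summable sequences *)

Section SquareSummable.
Variable R : realType.
Implicit Types (a b : nat -> R) (c : R).

Definition square_summable a := cvgn (series (fun n => a n ^+ 2)).

Definition dot a b : R := limn (series (fun n => a n * b n)).

Lemma cvg_series_dominated (u v : nat -> R) : (forall n, `|u n| <= v n) ->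
  cvgn (series v) -> cvgn (series u).
Proof.
move=> uv cv; apply: normed_cvg; apply: series_le_cvg cv => // n.
  exact: normr_ge0.
exact: (le_trans (normr_ge0 _) (uv n)).
Qed.

Lemma cvg_dot a b : square_summable a -> square_summable b ->
  cvgn (series (fun n => a n * b n)).
Proof.
move=> ha hb.
apply: (@cvg_series_dominated _ (fun n => a n ^+ 2 + b n ^+ 2)).
  by move=> n; rewrite ler_norml; apply/andP; split; nra.
exact: (is_cvg_seriesD ha hb).
Qed.

Lemma square_summable0 : square_summable (fun=> 0).
Proof.
rewrite /square_summable.
suff -> : series (fun _ : nat => (0 : R) ^+ 2) = fun=> 0 by exact: is_cvg_cst.
by apply/funext => n; rewrite /series /= big1// => i _; rewrite expr0n.
Qed.

Lemma square_summable_lin c a b : square_summable a -> square_summable b ->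
  square_summable (fun n => c * a n + b n).
Proof.
move=> ha hb.
apply: (@cvg_series_dominated _ (fun n => (2 * c ^+ 2) * a n ^+ 2 + 2 * b n ^+ 2)).
  move=> n; rewrite ger0_norm ?sqr_ge0//.
  have := sqr_ge0 (c * a n - b n); nra.
have cZ d (u : nat -> R) : cvgn (series u) -> cvgn (series (fun n => d * u n)).
  exact: is_cvg_seriesZ.
exact: (is_cvg_seriesD (cZ _ _ ha) (cZ _ _ hb)).
Qed.

Lemma square_summableB a b : square_summable a -> square_summable b ->
  square_summable (fun n => a n - b n).
Proof.
move=> ha hb; have := square_summable_lin (c := -1) hb ha.
by congr square_summable; apply/funext => n; rewrite mulN1r addrC.
Qed.

Lemma dotC a b : dot a b = dot b a.
Proof. by rewrite /dot; congr (limn (series _)); apply/funext => n; rewrite mulrC. Qed.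

Lemma dot_linl c a b d : square_summable a -> square_summable b ->
  square_summable d ->
  dot (fun n => c * a n + b n) d = c * dot a d + dot b d.
Proof.
move=> ha hb hd; have ca := cvg_dot ha hd; have cb := cvg_dot hb hd.
apply/cvg_lim => //.
have -> : series (fun n => (c * a n + b n) * d n) =
    fun N => c * series (fun n => a n * d n) N + series (fun n => b n * d n) N.
  apply/funext => N; rewrite /series /= mulr_sumr -big_split /=.
  by apply: eq_bigr => n _; rewrite mulrDl -mulrA.
by apply: cvgD => //; apply: cvgM => //; exact: cvg_cst.
Qed.

Lemma dot_ge_partial a N : square_summable a ->
  \sum_(0 <= n < N) a n ^+ 2 <= dot a a.
Proof.
move=> ha; apply: (@nondecreasing_cvgn_le _ (series (fun n => a n * a n))).
  by apply: nondecreasing_series => n _ _; rewrite -expr2 sqr_ge0.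
exact: cvg_dot.
Qed.

Lemma dot_ge0 a : square_summable a -> 0 <= dot a a.
Proof. by move=> /(dot_ge_partial 0); rewrite big_geq. Qed.

Lemma sqr_le_dot a n : square_summable a -> a n ^+ 2 <= dot a a.
Proof.
move=> ha; apply: le_trans (dot_ge_partial n.+1 ha).
rewrite big_nat_recr //= lerDr; apply: sumr_ge0 => i _; exact: sqr_ge0.
Qed.

Lemma dot_eq0 a : square_summable a -> dot a a = 0 -> a = fun=> 0.
Proof.
move=> ha a0; apply/funext => n; apply/eqP; rewrite -sqrf_eq0 eq_le sqr_ge0.
by rewrite -a0 sqr_le_dot.
Qed.

Lemma bounded_square_summable a M :
  (forall N, \sum_(0 <= n < N) a n ^+ 2 <= M) ->
  square_summable a /\ dot a a <= M.
Proof.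
move=> aM.
have nd : nondecreasing_seq (series (fun n => a n ^+ 2)).
  by apply: nondecreasing_series => n _ _; exact: sqr_ge0.
have ha : square_summable a.
  apply: nondecreasing_is_cvgn => //; exists M => _ [n _ <-]; exact: aM.
split=> //; apply: limr_le; first exact: cvg_dot.
by apply: nearW => n; exact: aM.
Qed.

Lemma finite_square_summable a N : (forall n, (N <= n)%N -> a n = 0) ->
  square_summable a.
Proof.
move=> a0; suff H M : \sum_(0 <= n < M) a n ^+ 2 <= \sum_(0 <= n < N) a n ^+ 2.
  by case: (bounded_square_summable H).
have [MN|/ltnW NM] := leqP M N.
  rewrite (big_cat_nat (leq0n M) MN) //= lerDl.
  by apply: sumr_ge0 => i _; exact: sqr_ge0.
rewrite [leLHS](big_cat_nat (leq0n N) NM) //= [X in _ + X]big_nat [X in _ + X]big1 ?addr0//.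
by move=> i /andP[Ni _]; rewrite a0// expr0n.
Qed.

Lemma dot_finite a b N : (forall n, (N <= n)%N -> a n = 0) ->
  dot a b = \sum_(0 <= n < N) a n * b n.
Proof.
move=> a0; rewrite /dot; apply/cvg_lim => //; apply: cvg_near_cst.
exists N => // n /= Nn; rewrite /series /= [LHS](big_cat_nat (leq0n N) Nn) //=.
rewrite [X in _ + X]big_nat [X in _ + X]big1 ?addr0//.
by move=> i /andP[Ni _]; rewrite a0// mul0r.
Qed.

(** A squared coordinate is at most the whole sum, so Cauchy in norm gives Cauchy in each
    coordinate. Coordinatewise convergence stays in the conclusion so that constraints on single
    coordinates can be passed to the limit. *)
Lemma l2_complete (u : nat -> nat -> R) :
  (forall n, square_summable (u n)) ->
  (forall e, 0 < e -> exists N, forall m n, (N <= m)%N -> (N <= n)%N ->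
    Num.sqrt (dot (fun i => u m i - u n i) (fun i => u m i - u n i)) < e) ->
  exists a, [/\ square_summable a, (forall i, (u ^~ i) @ \oo --> a i) &
    forall e, 0 < e -> exists N, forall n, (N <= n)%N ->
    Num.sqrt (dot (fun i => u n i - a i) (fun i => u n i - a i)) < e].
Proof.
move=> hu cauchy.
have cu i : cvgn (u ^~ i).
  apply/cauchy_cvgP/cauchy_ballP => e e0; have [N hN] := cauchy e e0.
  exists ([set u n i | n in [set n | (N <= n)%N]],
          [set u n i | n in [set n | (N <= n)%N]]).
    by split; exists N => // n /= Nn; exists n.
  move=> [_ _] /= [[m Nm <-] [n Nn <-]]; rewrite /ball /=.
  apply: le_lt_trans (hN m n Nm Nn).
  rewrite -sqrtr_sqr ler_wsqrtr//.
  exact: (@sqr_le_dot (fun i => u m i - u n i) i (square_summableB (hu m) (hu n))).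
pose a i := limn (u ^~ i).
(* For fixed [M] the sum is finite, so letting [m] tend to infinity keeps the Cauchy bound; [N] does
   not depend on [M]. *)
have tail e : 0 < e -> exists N, forall n, (N <= n)%N ->
    forall M, \sum_(0 <= i < M) (u n i - a i) ^+ 2 <= e ^+ 2.
  move=> e0; have [N hN] := cauchy e e0; exists N => n Nn M.
  have cs : (fun m => \sum_(0 <= i < M) (u n i - u m i) ^+ 2) @ \oo -->
      \sum_(0 <= i < M) (u n i - a i) ^+ 2.
    apply: cvg_big => [|i _]; first exact: add_continuous.
    have ci : (fun m => u n i - u m i) @ \oo --> u n i - a i.
      by apply: cvgB; [exact: cvg_cst|exact: cu].
    exact: (cvgM ci ci).
  rewrite -(cvg_lim _ cs)//; apply: limr_le; first by apply/cvg_ex; eexists; exact: cs.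
  exists N => // m /= Nm; have hB := square_summableB (hu n) (hu m).
  apply: le_trans (dot_ge_partial M hB) _.
  have := ltW (hN n m Nn Nm).
  by rewrite -{1}(ger0_norm (ltW e0)) -sqrtr_sqr ler_sqrt// sqr_ge0.
have sBa n e : 0 < e -> (forall M, \sum_(0 <= i < M) (u n i - a i) ^+ 2 <= e ^+ 2) ->
    square_summable (fun i => u n i - a i) /\
    dot (fun i => u n i - a i) (fun i => u n i - a i) <= e ^+ 2.
  by move=> _; exact: (@bounded_square_summable (fun i => u n i - a i)).
exists a; split=> //.
  (* Here [a] is square-summable as the difference of [u N] and [u N - a]. *)
  have [N hN] := tail 1 ltr01.
  have [hB _] := sBa N 1 ltr01 (hN N (leqnn N)).
  have := square_summableB (hu N) hB.
  by congr square_summable; apply/funext => i; rewrite opprB addrC subrK.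
move=> e e0; have e20 : 0 < e / 2 by rewrite divr_gt0.
have [N hN] := tail _ e20; exists N => n Nn.
have [hB le2] := sBa n _ e20 (hN n Nn).
apply: le_lt_trans (_ : e / 2 < e); last by rewrite ltr_pdivrMr// mulr2n; lra.
by rewrite -(ger0_norm (ltW e20)) -sqrtr_sqr ler_wsqrtr.
Qed.

(** Cutting at [n] splits [a] orthogonally, so the squared norm of the tail is [dot a a] minus the
    [n]-th partial sum. *)
Lemma dot_truncation a e : square_summable a -> 0 < e ->
  exists N, forall n, (N <= n)%N ->
  dot (fun i => if (i < n)%N then 0 else a i)
      (fun i => if (i < n)%N then 0 else a i) < e.
Proof.
move=> ha e0.
have ca := cvg_dot ha ha.
have /cvgr_dist_lt/(_ e e0)[N _ hN] := ca.
exists N => n /= Nn; have := hN n Nn; apply: le_lt_trans.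
pose h i := if (i < n)%N then a i else 0.
have hh : square_summable h.
  by apply: (@finite_square_summable h n) => i; rewrite /h leqNgt => /negbTE ->.
have ht : square_summable (fun i => if (i < n)%N then 0 else a i).
  have := square_summableB ha hh.
  by congr square_summable; apply/funext => i; rewrite /h; case: ifP; rewrite ?subrr ?subr0.
rewrite -[limn _]/(dot a a).
have -> : dot a a = dot (fun i => 1 * h i + (if (i < n)%N then 0 else a i)) a.
  by congr dot; apply/funext => i; rewrite /h; case: ifP; rewrite mul1r ?addr0 ?add0r.
rewrite dot_linl// mul1r (@dot_finite h a n); last first.
  by move=> i; rewrite /h leqNgt => /negbTE ->.
have -> : \sum_(0 <= i < n) h i * a i = series (fun i => a i * a i) n.
  by rewrite /series /= !big_nat; apply: eq_bigr => i /andP[_ ni]; rewrite /h ni.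
rewrite addrAC subrr add0r.
have <- : dot (fun i => if (i < n)%N then 0 else a i) (fun i => if (i < n)%N then 0 else a i) =
  dot (fun i => if (i < n)%N then 0 else a i) a.
  by congr (limn (series _)); apply/funext => i; case: ifP; rewrite ?mul0r.
exact: ler_norm.
Qed.

End SquareSummable.

(** * Compact metric spaces *)

Lemma exists_invSn_lt (R : realType) (e : R) : 0 < e ->
  exists n, n.+1%:R^-1 < e.
Proof.
move=> e0; exists (Num.truncn e^-1).
by rewrite invf_plt ?posrE// truncnS_gt.
Qed.

Section Metric.
Variables (R : realType) (X : topologicalType) (d : X -> X -> R).
Hypothesis d_metric : is_metric d.

Lemma metric_refl x : d x x = 0.
Proof. by apply/(Defs.metric_eq0 d_metric). Qed.

Lemma metric_dist_le x y z : `|d x y - d x z| <= d y z.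
Proof.
have := Defs.metric_triangle d_metric x y z; have := Defs.metric_triangle d_metric x z y.
rewrite (Defs.metric_sym d_metric z y) => h1 h2; rewrite ler_norml; apply/andP; split; lra.
Qed.

(** If [A] is open and contains [x], the image under [d x] of the compact complement of [A] is
    closed and omits 0, hence omits a ball about 0. Conversely, continuity of [d x] makes metric
    balls neighbourhoods. *)
Lemma continuous_metric_generates : compact [set: X] ->
  continuous (fun z : X * X => d z.1 z.2) -> generates_topology d.
Proof.
move=> cX dc.
have dxc x : continuous (d x).
  move=> y; apply: (@continuous_comp _ _ _ (fun y => (x, y)) (fun z => d z.1 z.2)).
    by apply: cvg_pair; [exact: cvg_cst|exact: cvg_id].
  exact: dc.
move=> A; split=> [oA x Ax|hA].
- have cAC : compact (d x @` ~` A).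
    apply: continuous_compact; first exact: continuous_subspaceT.
    by apply: (subclosed_compact (open_closedC oA) cX).
  have : nbhs (0 : R) (~` (d x @` ~` A)).
    apply: open_nbhs_nbhs; split.
      by apply: closed_openC; exact: (compact_closed (@norm_hausdorff _ R)).
    by move=> [y nAy /(Defs.metric_eq0 d_metric) xy]; apply: nAy; rewrite -xy.
  move=> /nbhs_ballP[e /= e0 he]; exists e => // y /= dxy; apply: contrapT => nAy.
  apply: (he (d x y)); last by exists y.
  by rewrite /ball /= sub0r normrN ger0_norm// (Defs.metric_ge0 d_metric).
- rewrite openE => x /hA[e e0 he]; apply: filterS he _.
  have /cvgrPdist_lt/(_ e e0) := dxc x x; rewrite metric_refl.
  by apply: filterS => y; rewrite /= sub0r normrN ger0_norm// (Defs.metric_ge0 d_metric).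
Qed.

Hypothesis d_gen : generates_topology d.

Lemma open_metric_ball x e : open [set y | d x y < e].
Proof.
apply/d_gen => y /= dxy; exists (e - d x y); first by rewrite subr_gt0.
by move=> z /= dyz; have := Defs.metric_triangle d_metric x y z; lra.
Qed.

Lemma nbhs_metricP x A :
  nbhs x A <-> exists2 e : R, 0 < e & [set y | d x y < e] `<=` A.
Proof.
split=> [|[e e0 he]].
  rewrite nbhsE => -[B [oB Bx] BA].
  have [e e0 he] := (d_gen B).1 oB x Bx.
  by exists e => // y /he /BA.
apply: filterS he _; apply: open_nbhs_nbhs; split; first exact: open_metric_ball.
by rewrite /= metric_refl.
Qed.

Lemma metric_continuous x : continuous (d x).
Proof.
move=> y; apply/cvgrPdist_lt => e e0; apply/nbhs_metricP; exists e => // z /=.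
exact: le_lt_trans (metric_dist_le _ _ _).
Qed.

Hypothesis X_compact : compact [set: X].

(** Compactness enters through near-coverings, along the filter of finite lists ordered by
    inclusion: what holds near each point for all large enough lists holds everywhere for one
    list. *)
Lemma compact_finite_net e : 0 < e ->
  exists s : seq X, forall y, exists2 x, x \in s & d x y < e.
Proof.
move=> e0.
pose F := filter_from [set: seq X] (fun s0 => [set s : seq X | {subset s0 <= s}]).
have FF : Filter F.
  apply: filter_from_filter; first by exists [::].
  move=> s t _ _; exists (s ++ t) => // u /= stu.
  by split=> x xs; apply: stu; rewrite mem_cat xs ?orbT.
have /compact_near_coveringP/(_ _ F
    (fun s y => exists2 x, x \in s & d x y < e) FF) := X_compact.
case=> [x _|s _ hs]; last by exists s => y; apply: (hs s).
exists ([set y | d x y < e], [set s : seq X | x \in s]).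
  split; first by apply/nbhs_metricP; exists e.
  by exists [:: x] => // s /= sx; apply: sx; rewrite inE.
by move=> [y s] /= [dxy xs]; exists x.
Qed.

(** The near-covering argument again, now along the filter of radii tending to 0 from the right. *)
Lemma compact_uniformly_continuous (f : X -> R) : continuous f ->
  forall e, 0 < e -> exists2 r, 0 < r &
  forall x y, d x y < r -> `|f x - f y| < e.
Proof.
move=> cf e e0.
have /compact_near_coveringP/(_ _ (0 : R)^'+
   (fun r x => forall y, d x y < r -> `|f x - f y| < e)) := X_compact.
case=> [x _|r /= r0 hr].
  have e20 : 0 < e / 2 by rewrite divr_gt0.
  have /cvgrPdist_lt/(_ _ e20)/nbhs_metricP[r r0 hr] := cf x.
  (* Halving leaves room for both [x'] and [y] to stay within [r] of [x]. *)
  exists ([set y | d x y < r / 2], [set s | s < r / 2]).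
    split; first by apply/nbhs_metricP; exists (r / 2) => //; rewrite divr_gt0.
    by apply: nbhs_right_lt; rewrite divr_gt0.
  move=> [x' s] /= [dxx' sr] y dx'y.
  have h1 : `|f x - f x'| < e / 2 by apply: hr => /=; lra.
  have h2 : `|f x - f y| < e / 2.
    by apply: hr => /=; have := Defs.metric_triangle d_metric x x' y; lra.
  have -> : f x' - f y = (f x - f y) - (f x - f x') by ring.
  by apply: le_lt_trans (ler_normB _ _) _; lra.
exists (r / 2); first by rewrite divr_gt0.
move=> x y; apply: (hr (r / 2)) => //=; last by rewrite divr_gt0.
rewrite /ball /= sub0r normrN ger0_norm ?divr_ge0 ?ltW//.
by rewrite ltr_pdivrMr// mulr2n; lra.
Qed.

(** A cluster point of a Cauchy sequence is its limit; the union of finite nets of mesh 1/(n+1) is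
    countable and dense. *)
Lemma compact_metric_polish : polish R X.
Proof.
split; last first.
  exists d; split=> // u cu.
  have [x [_ ux]] := X_compact (fmap_proper_filter u eventually_filter) filterT.
  exists x => e e0; have e20 : 0 < e / 2 by rewrite divr_gt0.
  have [N hN] := cu _ e20; exists N => n Nn.
  have [||y [[m /= Nm <-] dxy]] := ux [set u m | m in [set m | (N <= m)%N]]
    [set y | d x y < e / 2].
  - by exists N => // m Nm; exists m.
  - by apply/nbhs_metricP; exists (e / 2).
  have := Defs.metric_triangle d_metric (u n) (u m) x; have := hN n m Nn Nm.
  by move: dxy => /=; rewrite (Defs.metric_sym d_metric (u m) x); lra.
have net n : exists s : seq X, forall y, exists2 x, x \in s & d x y < n.+1%:R^-1.
  by apply: compact_finite_net; rewrite invr_gt0 ltr0n.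
exists (\bigcup_n [set` sval (cid (net n))]); split.
  by apply: bigcup_countable => // n _; apply: finite_set_countable; exact: finite_seq.
move=> O [x Ox] oO; have [e e0 he] := (d_gen O).1 oO x Ox.
have [n ne] := exists_invSn_lt e0; have := svalP (cid (net n)) x.
move=> [y ys dyx]; exists y; split; last by exists n.
by apply: he; rewrite /= (Defs.metric_sym d_metric); exact: lt_trans ne.
Qed.

End Metric.

(** * Regularity of finite Borel measures *)

Section Regularity.
Variables (R : realType) (X : topologicalType) (x0 : X).

Lemma open_borel_measurable (O : set X) : open O ->
  measurable (O : set (borel x0)).
Proof. by move=> oO; exact: sub_sigma_algebra. Qed.

Lemma closed_borel_measurable (F : set X) : closed F ->
  measurable (F : set (borel x0)).
Proof.
move=> cF; rewrite -[F]setCK; apply: measurableC.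
exact: open_borel_measurable (closed_openC cF).
Qed.

(** Continuity from above. It replaces an infinite intersection by a finite stage, both for open
    sets and for countable unions. *)
Lemma measure_lt_of_bigcap_lt (d : measure_display) (T : measurableType d)
    (nu : {finite_measure set T -> \bar R}) (F : nat -> set T) (e : R) :
  (forall n, measurable (F n)) -> (forall n, F n.+1 `<=` F n) ->
  (nu (\bigcap_n F n) < e%:E)%E -> exists n, (nu (F n) < e%:E)%E.
Proof.
move=> mF dF lte.
have F0 : (nu (F 0%N) < +oo)%E by rewrite ltey_eq fin_num_measure.
have mI : measurable (\bigcap_n F n) by apply: bigcap_measurable => // n _.
have ndF : {homo F : n m / (n <= m)%N >-> (m <= n)%O}.
  by apply/nonincreasing_seqP => n; apply/subsetPset.
have cF := nonincreasing_cvg_mu F0 mF mI ndF.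
have : nbhs (nu (\bigcap_n F n)) [set y | (y < e%:E)%E].
  by apply: open_nbhs_nbhs; split => //; exact: open_ereal_lt_ereal.
by move=> /cF[N _ /(_ N)/= h]; exists N; exact: h.
Qed.

Variables (d : X -> X -> R).
Hypotheses (d_metric : is_metric d) (d_gen : generates_topology d).
Variable nu : {finite_measure set (borel x0) -> \bar R}.

(** Inner closed and outer open approximation are bundled: this makes the notion symmetric under
    complement, so that the regular sets form a sigma-algebra. *)
Let regular (B : set (borel x0)) := forall e : R, 0 < e ->
  exists F U : set X, [/\ closed F, open U, F `<=` B, B `<=` U &
    (nu (U `\` F : set (borel x0)) < e%:E)%E].

Let mdiff (F U : set X) : closed F -> open U ->
  measurable (U `\` F : set (borel x0)).
Proof.
by move=> cF oU; apply: measurableD;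
  [exact: open_borel_measurable|exact: closed_borel_measurable].
Qed.

Let regularC B : regular B -> regular (~` B).
Proof.
move=> rB e e0; have [F [U [cF oU FB BU h]]] := rB e e0.
exists (~` U), (~` F); split.
- exact: open_closedC.
- exact: closed_openC.
- exact: subsetC.
- exact: subsetC.
- by rewrite setDE setCK setIC -setDE.
Qed.

Let regular_open (O : set X) : open O -> regular O.
Proof.
move=> oO e e0.
(* The points at distance at least 1/(n+1) from the complement of [O], written pointwise to avoid an
   infimum over a possibly empty set. *)
pose F n := [set x | forall y, ~ O y -> n.+1%:R^-1 <= d x y].
have cF n : closed (F n).
  rewrite -[F n]setCK; apply: open_closedC; rewrite openE => x.
  move=> /existsNP[y /not_implyP[nOy /negP]]; rewrite -ltNge => lt.
  apply: filterS (_ : [set z | d y z < n.+1%:R^-1] `<=` _) _.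
    move=> z /=; rewrite (Defs.metric_sym d_metric y z) => dzy /(_ y nOy).
    by rewrite leNgt dzy.
  apply: open_nbhs_nbhs; split; first exact: open_metric_ball.
  by rewrite /= (Defs.metric_sym d_metric).
have FO n : F n `<=` O.
  move=> x Fx; apply: contrapT => nOx; have := Fx x nOx.
  by rewrite metric_refl// leNgt invr_gt0 ltr0n.
have [n hn] : exists n, (nu (O `\` F n : set (borel x0)) < e%:E)%E.
  apply: measure_lt_of_bigcap_lt.
  - by move=> n; exact: mdiff.
  - move=> n x [Ox nFx]; split=> // Fx; apply: nFx => y /Fx; apply: le_trans.
    by rewrite lef_pV2 ?posrE ?ltr0n// ler_nat.
  rewrite (_ : \bigcap_n _ = set0) ?measure0 ?lte_fin//.
  apply/seteqP; split=> // x h; have [Ox _] := h 0%N Logic.I.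
  have [r r0 hr] := (d_gen O).1 oO x Ox; have [n nr] := exists_invSn_lt r0.
  have [_ []] := h n Logic.I => y nOy; rewrite leNgt; apply/negP => lt.
  by apply: nOy; apply: hr => /=; exact: lt_trans nr.
by exists (F n), O; split.
Qed.

(** The errors of the single sets add up to at most [e / 2]. The union of all inner sets need not be
    closed, so it is cut to a finite union, and continuity from above keeps the total below [e]. *)
Let regular_bigcup (A : nat -> set (borel x0)) :
  (forall n, regular (A n)) -> regular (\bigcup_n A n).
Proof.
move=> rA e e0.
have h n : exists FU : set X * set X, [/\ closed FU.1, open FU.2, FU.1 `<=` A n,
    A n `<=` FU.2 & (nu (FU.2 `\` FU.1 : set (borel x0)) <= (e / 2 / (2 ^ n.+1)%:R)%:E)%E].
  have [|F [U [cF oU FA AU /ltW lt]]] := rA n (e / 2 / (2 ^ n.+1)%:R).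
    by rewrite !divr_gt0// ltr0n expn_gt0.
  by exists (F, U).
pose F n := (sval (cid (h n))).1; pose U n := (sval (cid (h n))).2.
have cF n : closed (F n) by have [] := svalP (cid (h n)).
have oU n : open (U n) by have [] := svalP (cid (h n)).
have FA n : F n `<=` A n by have [] := svalP (cid (h n)).
have AU n : A n `<=` U n by have [] := svalP (cid (h n)).
have FU n : (nu (U n `\` F n : set (borel x0)) <= (e / 2 / (2 ^ n.+1)%:R)%:E)%E.
  by have [] := svalP (cid (h n)).
have oUU : open (\bigcup_n U n) by apply: bigcup_open => n _.
pose G n := \bigcup_(i in `I_n) F i.
have cG n : closed (G n) by apply: closed_bigcup => //; exact: finite_II.
have [n hn] : exists n, (nu (\bigcup_n U n `\` G n : set (borel x0)) < e%:E)%E.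
  apply: measure_lt_of_bigcap_lt.
  - by move=> n; exact: mdiff.
  - move=> n x [Ux nGx]; split=> // -[i /= ni Fi]; apply: nGx; exists i => //=.
    exact: ltnW.
  have mI : measurable (\bigcap_n (\bigcup_n U n `\` G n) : set (borel x0)).
    by apply: bigcap_measurable => // n _; exact: mdiff.
  apply: le_lt_trans (_ : ((e / 2)%:E < e%:E)%E); last first.
    by rewrite lte_fin ltr_pdivrMr// mulr2n; lra.
  have sub : \bigcap_n (\bigcup_n U n `\` G n) `<=` \bigcup_n (U n `\` F n).
    move=> x hx; have [[n _ Ux] _] := hx 0%N Logic.I; exists n => //; split=> // Fx.
    (* The first stage that includes [F n] is [G n.+1]. *)
    by have [_] := hx n.+1 Logic.I; apply; exists n => /=.
  apply: le_trans (measure_sigma_subadditive nu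
    (F := fun n => U n `\` F n : set (borel x0)) (fun n => mdiff (cF n) (oU n)) mI sub) _.
  apply: le_trans (epsilon_trick0 xpredT (_ : 0 <= e / 2)); last by rewrite divr_ge0// ltW.
  by apply: lee_nneseries => // n _; exact: FU.
exists (G n), (\bigcup_n U n); split=> //.
  by move=> x [i _ /FA Ax]; exists i.
by move=> x [i _ /AU Ux]; exists i.
Qed.

(** The regular sets form a sigma-algebra that contains the open sets. *)
Lemma borel_regular (B : set (borel x0)) : measurable B ->
  forall e : R, 0 < e ->
  exists F U : set X, [/\ closed F, open U, F `<=` B, B `<=` U &
    (nu (U `\` F : set (borel x0)) < e%:E)%E].
Proof.
suff : measurable `<=` regular by apply.
apply: smallest_sub; last by move=> O; exact: regular_open.
split=> [|A rA|A rA]; last exact: regular_bigcup.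
  by apply: regular_open; exact: open0.
by rewrite setTD; exact: regularC.
Qed.

Hypotheses (X_compact : compact [set: X]) (X_hausdorff : hausdorff_space X).

(** Closed subsets of [X] are compact, so closed approximation from inside is approximation by
    compact sets; compact sets are closed in a Hausdorff space, hence Borel. *)
Lemma compact_metric_radon : radon nu.
Proof.
move=> B mB.
have sub (F U : set X) e : closed F -> open U -> F `<=` B -> B `<=` U ->
    (nu (U `\` F : set (borel x0)) < e%:E)%E ->
    (nu B <= nu (F : set (borel x0)) + e%:E)%E /\
    (nu (U : set (borel x0)) <= nu B + e%:E)%E.
  move=> cF oU FB BU /ltW h.
  have mF := closed_borel_measurable cF; have mU := open_borel_measurable oU.
  split.
    have -> : B = F `|` (B `\` F) by rewrite setDUK.
    rewrite measureU//; last by rewrite setDIK.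
      rewrite leeD2l//; apply: le_trans h; apply: le_measure; rewrite ?inE//.
      - exact: measurableD.
      - exact: mdiff.
      - exact: setSD.
    exact: measurableD.
  have -> : U = B `|` (U `\` B) by rewrite setDUK.
  rewrite measureU//; last by rewrite setDIK.
    rewrite leeD2l//; apply: le_trans h; apply: le_measure; rewrite ?inE//.
    - exact: measurableD.
    - exact: mdiff.
    - exact: setDS.
  exact: measurableD.
split; apply/eqP; rewrite eq_le; apply/andP; split.
- apply/lee_addgt0Pr => e e0.
  have [F [U [cF oU FB BU h]]] := borel_regular mB e0.
  apply: le_trans (sub _ _ _ cF oU FB BU h).1 _.
  rewrite leeD2r//; apply: ereal_sup_ubound; exists F => //; split=> //.
  exact: subclosed_compact X_compact _.
- apply: ge_ereal_sup => _ [K [cK KB] <-]; apply: le_measure; rewrite ?inE//.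
  exact: closed_borel_measurable (compact_closed _ cK).
- apply: le_ereal_inf_tmp => _ [U [oU BU] <-]; apply: le_measure; rewrite ?inE//.
  exact: open_borel_measurable.
- apply/lee_addgt0Pr => e e0.
  have [F [U [cF oU FB BU h]]] := borel_regular mB e0.
  apply: le_trans (sub _ _ _ cF oU FB BU h).2.
  by apply: ereal_inf_lbound; exists U.
Qed.

End Regularity.

(** The two parts of a Jordan decomposition are finite measures, hence Radon by regularity. *)
Lemma signed_radon_measuresE (R : realType) (X : topologicalType)
    (d : X -> X -> R) (x0 : X) :
  is_metric d -> generates_topology d -> compact [set: X] ->
  hausdorff_space X -> signed_radon_measures R x0 = signed_measures R x0.
Proof.
move=> d_metric d_gen cX hX; apply/seteqP; split=> // nu _.
have [P [N nuPN]] := Hahn_decomposition nu.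
exists (jordan_pos nuPN), (jordan_neg nuPN); split.
- exact: (compact_metric_radon d_metric d_gen).
- exact: (compact_metric_radon d_metric d_gen).
by move=> B mB; rewrite {1}(jordan_decomp nuPN mB) /cadd /= /cscale /= EFinN mulN1e.
Qed.

(** * From kernels to metrics *)

Section CompactHausdorff.
Variables (R : realType) (X : topologicalType).
Hypotheses (X_compact : compact [set: X]).

(** Compactness bounds the range; the supremum of an unbounded set would be a default value. *)
Lemma compact_sup_norm_ge (f : X -> R) x : continuous f -> `|f x| <= sup_norm f.
Proof.
move=> cf; apply: ub_le_sup; last by exists x.
suff [] : has_sup (range (fun x => `|f x|)) by [].
apply: compact_has_sup; first by exists `|f x|, x.
apply: continuous_compact => //; apply: continuous_subspaceT => y.
by apply: continuous_comp; [exact: cf|exact: norm_continuous].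
Qed.

Hypothesis X_hausdorff : hausdorff_space X.

Lemma closed_singleton (x : X) : closed [set x].
Proof. by apply: compact_closed => //; exact: compact_set1. Qed.

Lemma urysohn_compact_hausdorff (A B : set X) : closed A -> closed B ->
  A `&` B = set0 ->
  exists f : X -> R, [/\ continuous f, forall x, 0 <= f x <= 1,
    forall x, A x -> f x = 0 & forall x, B x -> f x = 1].
Proof.
move=> cA cB AB0; have nX := compact_normal X_hausdorff X_compact.
have [normal_sep _] := @normal_separatorP R X.
have [f [cf f01 fA fB]] := (@uniform_separatorP X R A B).1 (normal_sep nX A B cA cB AB0).
exists f; split=> // x.
- by have := f01 (f x) (ex_intro2 _ _ x Logic.I erefl); rewrite /= in_itv.
- by move=> Ax; apply: fA; exists x.
- by move=> Bx; apply: fB; exists x.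
Qed.

End CompactHausdorff.

(** * Cauchy-Schwarz and the norm distance in a Hilbert function space *)

Section HilbertFunctionSpace.
Variables (R : realType) (X : topologicalType) (H : set (X -> R)).
Variable ip : (X -> R) -> (X -> R) -> R.
Hypothesis H_hilbert : hilbert_function_space H ip.
Implicit Types f g h : X -> R.

Lemma hfs_sub f g : H f -> H g -> H (f - g).
Proof.
by move=> Hf Hg; have := hfs_lin H_hilbert (-1) Hg Hf; rewrite scaleN1r addrC.
Qed.

Lemma hfs_scale (a : R) f : H f -> H (a *: f).
Proof.
by move=> Hf; have := hfs_lin H_hilbert a Hf (hfs_zero H_hilbert); rewrite addr0.
Qed.

Lemma hfs_ip0l h : H h -> ip 0 h = 0.
Proof.
move=> Hh; have H0 := hfs_zero H_hilbert.
by have := hfs_ip_lin H_hilbert (-1) H0 H0 Hh; rewrite scaleN1r oppr0 addr0 mulN1r addNr.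
Qed.

Lemma hfs_ipBl f g h : H f -> H g -> H h -> ip (f - g) h = ip f h - ip g h.
Proof.
move=> Hf Hg Hh; rewrite addrC -scaleN1r (hfs_ip_lin H_hilbert)//.
by rewrite mulN1r addrC.
Qed.

(** General scalars serve the Cauchy-Schwarz inequality; with both equal to 1, the expansion gives
    symmetry, the triangle inequality and the formula for the kernel distance. *)
Lemma hfs_ip_sqB (a b : R) f g : H f -> H g ->
  ip (a *: f - b *: g) (a *: f - b *: g) =
  a ^+ 2 * ip f f - 2 * a * b * ip f g + b ^+ 2 * ip g g.
Proof.
move=> Hf Hg; have Hh := hfs_sub (hfs_scale a Hf) (hfs_scale b Hg).
have E h : H h -> ip (a *: f - b *: g) h = a * ip f h - b * ip g h.
  move=> Hh'; rewrite hfs_ipBl//; [|exact: hfs_scale..].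
  have Z c f' : H f' -> ip (c *: f') h = c * ip f' h.
    move=> Hf'; rewrite -[c *: f']addr0 (hfs_ip_lin H_hilbert) ?hfs_ip0l ?addr0//.
    exact: hfs_zero H_hilbert.
  by rewrite !Z.
rewrite E// !(hfs_ipC H_hilbert _ Hh)// !E// (hfs_ipC H_hilbert Hg Hf); ring.
Qed.

(** The squared norm of [ip g g *: f - ip f g *: g] is nonnegative and equals [ip g g] times the
    difference of the two sides; the case [ip g g = 0] forces [g = 0]. *)
Lemma hfs_cauchy_schwarz f g : H f -> H g ->
  ip f g ^+ 2 <= ip f f * ip g g.
Proof.
move=> Hf Hg; have := hfs_ip_ge0 H_hilbert Hg; rewrite le_eqVlt.
move=> /predU1P[/esym gg0|gg0].
  rewrite (hfs_ip_eq0 H_hilbert Hg gg0) (hfs_ipC H_hilbert Hf (hfs_zero H_hilbert)).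
  by rewrite !hfs_ip0l ?mulr0 ?expr0n//; exact: hfs_zero H_hilbert.
have := hfs_ip_ge0 H_hilbert (hfs_sub (hfs_scale (ip g g) Hf) (hfs_scale (ip f g) Hg)).
rewrite hfs_ip_sqB//.
have -> : ip g g ^+ 2 * ip f f - 2 * ip g g * ip f g * ip f g + ip f g ^+ 2 * ip g g
  = ip g g * (ip f f * ip g g - ip f g ^+ 2) by ring.
by rewrite pmulr_rge0// subr_ge0.
Qed.

Lemma hfs_ip_le f g : H f -> H g ->
  `|ip f g| <= Num.sqrt (ip g g) * Num.sqrt (ip f f).
Proof.
move=> Hf Hg; rewrite -sqrtr_sqr -sqrtrM ?(hfs_ip_ge0 H_hilbert)// ler_wsqrtr// mulrC.
exact: hfs_cauchy_schwarz.
Qed.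

Definition hfs_dist f g := Num.sqrt (ip (f - g) (f - g)).

Lemma hfs_dist_eq0 f g : H f -> H g -> (hfs_dist f g = 0 <-> f = g).
Proof.
move=> Hf Hg; have HB := hfs_sub Hf Hg; split=> [|->]; last first.
  by rewrite /hfs_dist subrr hfs_ip0l ?sqrtr0//; exact: hfs_zero H_hilbert.
move=> /eqP; rewrite sqrtr_eq0 => le0; apply/eqP; rewrite -subr_eq0; apply/eqP.
by apply: (hfs_ip_eq0 H_hilbert) => //; apply/eqP; rewrite eq_le le0 (hfs_ip_ge0 H_hilbert).
Qed.

Lemma hfs_distC f g : H f -> H g -> hfs_dist f g = hfs_dist g f.
Proof.
move=> Hf Hg; rewrite /hfs_dist; congr Num.sqrt.
have := @hfs_ip_sqB 1 1 _ _ Hf Hg; have := @hfs_ip_sqB 1 1 _ _ Hg Hf.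
by rewrite !scale1r => -> ->; rewrite (hfs_ipC H_hilbert Hf Hg); ring.
Qed.

Lemma hfs_dist_triangle f g h : H f -> H g -> H h ->
  hfs_dist f h <= hfs_dist f g + hfs_dist g h.
Proof.
move=> Hf Hg Hh; rewrite /hfs_dist.
have Hu := hfs_sub Hf Hg; have Hv := hfs_sub Hh Hg.
have -> : f - h = (f - g) - (h - g) by rewrite opprB addrA subrK.
have -> : Num.sqrt (ip (g - h) (g - h)) = Num.sqrt (ip (h - g) (h - g)).
  exact: hfs_distC.
move: (f - g) (h - g) Hu Hv => u v Hu Hv.
have u0 := hfs_ip_ge0 H_hilbert Hu; have v0 := hfs_ip_ge0 H_hilbert Hv.
set a := Num.sqrt (ip u u); set b := Num.sqrt (ip v v).
have a0 : 0 <= a by exact: sqrtr_ge0.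
have b0 : 0 <= b by exact: sqrtr_ge0.
(* After squaring, the claim is that [ip u v] is at least [- (a * b)], which is Cauchy-Schwarz. *)
rewrite -[leRHS](ger0_norm (addr_ge0 a0 b0)) -sqrtr_sqr ler_wsqrtr//.
have := @hfs_ip_sqB 1 1 _ _ Hu Hv; rewrite !scale1r => ->.
have := hfs_ip_le Hu Hv; rewrite -/a -/b ler_norml => /andP[le1 le2].
have <- : a ^+ 2 = ip u u by rewrite sqr_sqrtr.
have <- : b ^+ 2 = ip v v by rewrite sqr_sqrtr.
nra.
Qed.

End HilbertFunctionSpace.

(** * The metric induced by a kernel *)

Section KernelMetric.
Variables (R : realType) (X : topologicalType) (k : X -> X -> R).
Variables (H : set (X -> R)) (ip : (X -> R) -> (X -> R) -> R).
Hypothesis H_rkhs : is_rkhs k H ip.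

Let HH := rkhs_hilbert H_rkhs.
Let Hk := rkhs_kernel H_rkhs.

Lemma rkhs_ip_kernel x y : ip (k ^~ y) (k ^~ x) = k x y.
Proof. by rewrite -(rkhs_reproducing H_rkhs x (Hk y)). Qed.

(** Pull the norm distance back along the feature map. By the reproducing property its square is
    k(x,x) - 2k(y,x) + k(y,y), which is continuous, and injectivity separates points. *)
Lemma continuous_injective_kernel_metrizable : compact [set: X] ->
  continuous_kernel k -> injective (fun x => k ^~ x) -> metrizable R X.
Proof.
move=> cX ck ik; pose d x y := hfs_dist ip (k ^~ x) (k ^~ y).
have d_metric : is_metric d.
  split.
  - by move=> x y; exact: sqrtr_ge0.
  - move=> x y; split=> [/(hfs_dist_eq0 HH (Hk x) (Hk y))/ik//|->].
    exact/(hfs_dist_eq0 HH).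
  - by move=> x y; exact: (hfs_distC HH).
  - by move=> x y z; exact: (hfs_dist_triangle HH).
exists d; split=> //; apply: continuous_metric_generates => //.
have -> : (fun z : X * X => d z.1 z.2) =
    fun z => Num.sqrt (k z.1 z.1 - 2 * k z.2 z.1 + k z.2 z.2).
  apply/funext => -[x y]; rewrite /d /hfs_dist /=; congr Num.sqrt.
  have := @hfs_ip_sqB _ _ _ _ HH 1 1 _ _ (Hk x) (Hk y).
  by rewrite !scale1r => ->; rewrite !rkhs_ip_kernel; ring.
have ckc (f g : X * X -> X) : continuous f -> continuous g ->
    continuous (fun z => k (f z) (g z)).
  move=> cf cg z.
  apply: (@continuous_comp _ _ _ (fun z => (f z, g z)) (fun z => k z.1 z.2)).
    by apply: cvg_pair; [exact: cf|exact: cg].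
  exact: ck.
have c1 : continuous (fun z : X * X => z.1) by move=> z; exact: cvg_fst.
have c2 : continuous (fun z : X * X => z.2) by move=> z; exact: cvg_snd.
move=> z; apply: continuous_comp; last exact: sqrt_continuous.
apply: cvgD; last exact: ckc.
apply: cvgB; first exact: ckc.
by apply: cvgM; [exact: cvg_cst|exact: ckc].
Qed.

End KernelMetric.

(** If the features of [x] and [y] agree, every member of [H] takes equal values at [x] and [y], so
    it cannot come within 1/2 of a Urysohn function equal to 0 at [x] and 1 at [y]. *)
Lemma universal_metrizable (R : realType) (X : topologicalType)
    (k : X -> X -> R) : compact [set: X] -> hausdorff_space X ->
  universal k -> metrizable R X.
Proof.
move=> cX hX [ck [H [ip [Hr Hc Hd]]]].
apply: (continuous_injective_kernel_metrizable Hr cX ck) => x y kxy.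
apply: contrapT => /eqP xy.
have xy0 : [set x] `&` [set y] = set0.
  by apply/seteqP; split=> // z [/= -> xy']; rewrite xy' eqxx in xy.
have [f [cf _ fx fy]] := @urysohn_compact_hausdorff R X cX hX [set x] [set y]
  (@closed_singleton _ hX x) (@closed_singleton _ hX y) xy0.
have [h Hh lt] := Hd f cf (1 / 2) (divr_gt0 ltr01 (ltr0Sn R 1)).
have hxy : h x = h y.
  by rewrite (rkhs_reproducing Hr x Hh) (rkhs_reproducing Hr y Hh) kxy.
have cB : continuous (f - h) by move=> z; apply: cvgB; [exact: cf|exact: Hc].
have := compact_sup_norm_ge cX x cB; have := compact_sup_norm_ge cX y cB.
have -> : (f - h) x = - h x by rewrite /= -[RHS]add0r -(fx x).
have -> : (f - h) y = 1 - h y by rewrite /= -(fy y).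
rewrite -hxy; clear cB kxy xy0; move: (sup_norm (f - h)) lt => s lt.
rewrite !ler_norml => /andP[? ?] /andP[? ?]; lra.
Qed.

Lemma kernel_eval_bounded_linear (R : realType) (X : topologicalType)
    (k : X -> X -> R) H ip z : is_rkhs k H ip ->
  bounded_linear_functional H ip (fun f => ip f (k ^~ z)).
Proof.
move=> Hr; have Hk := rkhs_kernel Hr z; have HH := rkhs_hilbert Hr; split.
  by move=> a f g Hf Hg; exact: (hfs_ip_lin HH).
by eexists => f Hf; exact: (hfs_ip_le HH).
Qed.

(** The mean embedding sends the Dirac measure at [t] to the feature of [t]. Equal features thus
    give equal Dirac measures, and these are told apart on a closed singleton. *)
Lemma characteristic_metrizable (R : realType) (X : topologicalType)
    (k : X -> X -> R) : compact [set: X] -> hausdorff_space X ->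
  continuous_kernel k -> (forall x0, characteristic k x0) -> metrizable R X.
Proof.
move=> cX hX ck chark.
(* On the empty space the hypothesis on [x0] is vacuous, and any function is a metric. *)
have [[x0 _]|nX] := pselect (exists x : X, True); last first.
  have nox (x : X) : False by apply: nX; exists x.
  exists (fun _ _ => 0); split; last first.
    move=> A; split=> [_ x|_]; first by case: (nox x).
    rewrite (_ : A = set0); first exact: open0.
    by apply/seteqP; split=> // x; case: (nox x).
  by split=> x; case: (nox x).
have [_ _ [H [ip [Phi [Hr hPhi inj]]]]] := chark x0.
apply: (continuous_injective_kernel_metrizable Hr cX ck) => x y kxy.
(* The Pettis property is tested against evaluation at [z], written as an inner product with
   [k ^~ z]. *)
have Phi_dirac (t : X) : Phi (dirac (t : borel x0)) = k ^~ t.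
  apply/funext => z; have [HPhi pet] := hPhi (dirac (t : borel x0)).
  have [Hint] := pet _ (kernel_eval_bounded_linear z Hr).
  rewrite integral_dirac//; last exact: measurable_int Hint.
  rewrite diracT mul1e (rkhs_reproducing Hr z HPhi) => -[<-].
  by rewrite (rkhs_ip_kernel Hr).
have : Phi (dirac (x : borel x0)) = Phi (dirac (y : borel x0)).
  by rewrite !Phi_dirac.
move=> /inj/(_ _ (closed_borel_measurable (x0 := x0) (@closed_singleton _ hX x))).
rewrite [LHS]diracE [RHS]diracE mem_set//; case: (boolP (y \in _)) => [/set_mem -> //|_ /eqP].
by rewrite eqe oner_eq0.
Qed.

(** * A triangular sequence with dense span *)

Section Span.
Variables (R : realType) (X : Type).
Implicit Types (g : nat -> X -> R) (h : X -> R).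

Inductive in_span g : (X -> R) -> Prop :=
| in_span0 : in_span g 0
| in_spanD a m h : in_span g h -> in_span g (a *: g m + h).

Lemma in_span_lin g a h1 h2 : in_span g h1 -> in_span g h2 ->
  in_span g (a *: h1 + h2).
Proof.
move=> s1 s2; elim: s1 => [|b m h _ ih]; first by rewrite scaler0 add0r.
by rewrite scalerDr scalerA -addrA; exact: in_spanD.
Qed.

Lemma in_span_gen g m : in_span g (g m).
Proof. by have := in_spanD 1 m (in_span0 g); rewrite scale1r addr0. Qed.

Lemma in_span_trans g g' h : (forall m, in_span g' (g m)) ->
  in_span g h -> in_span g' h.
Proof.
move=> gg'; elim=> [|a m {}h _ ih]; first exact: in_span0.
exact: in_span_lin.
Qed.

Lemma in_span_sum g (I : eqType) (s : seq I) (c : I -> R) (f : I -> X -> R) :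
  (forall i, i \in s -> in_span g (f i)) ->
  in_span g (\sum_(i <- s) c i *: f i).
Proof.
elim: s => [|i s ih] hs; first by rewrite big_nil; exact: in_span0.
rewrite big_cons; apply: in_span_lin; first by apply: hs; rewrite mem_head.
by apply: ih => j js; apply: hs; rewrite inE js orbT.
Qed.

(* Step m subtracts from f the multiple of the m-th residual that makes f vanish
   at a point where that residual does not; a zero residual is skipped. *)
Fixpoint eliminate g m (f : X -> R) : X -> R :=
  if m is m'.+1 then
    let r := eliminate g m' (g m') in
    if pselect (exists t, r t != 0) is left h then
      let t := sval (cid h) in
      eliminate g m' f - (eliminate g m' f t / r t) *: r
    else eliminate g m' f
  else f.

Definition residual g m := eliminate g m (g m).

Lemma eliminateS g m f : exists c, eliminate g m.+1 f = eliminate g m f - c *: residual g m.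
Proof.
rewrite /=; case: pselect => [h|_]; first by eexists.
by exists 0; rewrite scale0r subr0.
Qed.

Lemma eliminate_span g m f : in_span (residual g) (f - eliminate g m f).
Proof.
elim: m => [|m ih]; first by rewrite subrr; exact: in_span0.
have [c ->] := eliminateS g m f.
by rewrite opprB addrCA; exact: in_spanD.
Qed.

(** Elimination subtracts only multiples of residuals, so passing to residuals keeps every [g m] in
    the span. *)
Lemma residual_span g m : in_span (residual g) (g m).
Proof.
have := in_span_lin 1 (in_span_gen (residual g) m) (eliminate_span g m (g m)).
by rewrite scale1r /residual addrC subrK.
Qed.

(** The point [t] is the pivot chosen at step [m]: that step makes every function vanish at [t], and
    later steps subtract multiples of residuals that already vanish there. *)
Lemma residual_triangular g m : residual g m = 0 \/
  exists2 t, residual g m t != 0 & forall j, (m < j)%N -> residual g j t = 0.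
Proof.
have [h|h] := pselect (exists t, residual g m t != 0); last first.
  left; apply/funext => t; apply: contrapT => /eqP nz; apply: h; by exists t.
right; pose t := sval (cid h).
have rt : residual g m t != 0 by exact: (svalP (cid h)).
exists t => // j mj.
(* Quantifying over [f] lets the induction hypothesis apply both to the function being reduced and
   to the residual subtracted from it. *)
suff e0 n f : eliminate g (m.+1 + n) f t = 0 by rewrite -(subnKC mj); exact: e0.
elim: n f => [|n ih] f.
  rewrite addn0 /=; case: pselect => [h'|]; last by move=> /(_ h).
  (* The pivot depends on the existence proof; identifying the two proofs identifies the pivots. *)
  rewrite (Prop_irrelevance h' h) -/t -/(residual g m).
  by rewrite /= !fctE /= /GRing.scale /= divfK// subrr.
rewrite addnS; have [c ->] := eliminateS g (m.+1 + n) f.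
by rewrite !fctE /residual !ih scaler0 subrr.
Qed.

End Span.

Lemma eliminate_continuous (R : realType) (X : topologicalType)
    (g : nat -> X -> R) m f : (forall m, continuous (g m)) ->
  continuous f -> continuous (eliminate g m f).
Proof.
move=> cg; elim: m f => [//|m ih] f cf.
have [c ->] := eliminateS g m f => x.
apply: cvgB; first exact: ih.
by apply: cvgM; [exact: cvg_cst|exact: ih].
Qed.

(** * Partitions of unity and a dense triangular sequence *)

Section DenseSequence.
Variables (R : realType) (X : topologicalType) (d : X -> X -> R).
Hypotheses (d_metric : is_metric d) (d_gen : generates_topology d).
Hypothesis X_compact : compact [set: X].

Let hat (w : R) (c x : X) : R := Num.max 0 (w - d c x).

Let tot (w : R) (s : seq X) (x : X) : R := \sum_(c <- s) hat w c x.

Let hat_ge0 w c x : 0 <= hat w c x.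
Proof. by rewrite le_max lexx. Qed.

Let hat_continuous w c : continuous (hat w c).
Proof.
move=> x; apply: (@continuous_max R X (fun=> 0) (fun x => w - d c x) x).
  exact: cvg_cst.
by apply: cvgB; [exact: cvg_cst|exact: (metric_continuous d_metric d_gen)].
Qed.

Let tot_continuous w s : continuous (tot w s).
Proof.
move=> x; apply: cvg_big => [|c _]; first exact: add_continuous.
exact: hat_continuous.
Qed.

Let tot_gt0 w s x : (exists2 c, c \in s & d c x < w) -> 0 < tot w s x.
Proof.
move=> [c cs dw]; rewrite /tot (big_rem c) //=.
apply: ltr_pwDl; last by apply: sumr_ge0.
by rewrite lt_max subr_gt0 dw orbT.
Qed.

(** Normalised tent functions over finite nets form partitions of unity. Weighting them by the
    values of [f] at the centres averages values of [f] taken near [x], and uniform continuity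
    bounds the error. *)
Lemma dense_sequence : exists g : nat -> X -> R,
  (forall m, continuous (g m)) /\
  forall f, continuous f -> forall e : R, 0 < e ->
  exists2 h, in_span g h & forall x, `|f x - h x| < e.
Proof.
have net n : exists s : seq X, forall y, exists2 x, x \in s & d x y < n.+1%:R^-1.
  by apply: (compact_finite_net d_metric d_gen X_compact); rewrite invr_gt0 ltr0n.
pose s n := sval (cid (net n)).
have sP n y : exists2 x, x \in s n & d x y < n.+1%:R^-1 by exact: (svalP (cid (net n))).
pose phi n c x := hat n.+1%:R^-1 c x / tot n.+1%:R^-1 (s n) x.
(* All net levels and positions are listed in one sequence; codes that name no centre give 0. *)
pose g m := if unpickle m is Some (n, i) then
  if onth (s n) i is Some c then phi n c else 0 else 0.
have g_phi n c : c \in s n -> exists m, g m = phi n c.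
  by move=> /onthP[i ci]; exists (pickle (n, i)); rewrite /g pickleK ci.
have phi_continuous n c : continuous (phi n c).
  move=> x; apply: cvgM; first exact: hat_continuous.
  by apply: cvgV; [rewrite gt_eqF ?tot_gt0|exact: tot_continuous].
exists g; split=> [m|f cf e e0].
  have c0 : continuous (0 : X -> R) by move=> x; exact: cvg_cst.
  rewrite /g; case: unpickle => [[n i]|//]; case: onth => [c|//].
  exact: phi_continuous.
have e20 : 0 < e / 2 by rewrite divr_gt0.
have [r r0 hr] := compact_uniformly_continuous d_metric d_gen X_compact cf e20.
have [n nr] := exists_invSn_lt r0.
exists (\sum_(c <- s n) f c *: phi n c).
  by apply: in_span_sum => c /g_phi[m <-]; exact: in_span_gen.
move=> x; have t0 : 0 < tot n.+1%:R^-1 (s n) x by exact: tot_gt0.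
have sum1 : \sum_(c <- s n) phi n c x = 1.
  by rewrite -mulr_suml divff// gt_eqF.
have -> : f x - (\sum_(c <- s n) f c *: phi n c) x =
    \sum_(c <- s n) (f x - f c) * phi n c x.
  rewrite fct_sumE.
  transitivity (f x * \sum_(c <- s n) phi n c x - \sum_(c <- s n) f c * phi n c x).
    by rewrite sum1 mulr1.
  by rewrite mulr_sumr -sumrB; apply: eq_bigr => c _; rewrite mulrBl.
apply: le_lt_trans (ler_norm_sum _ _ _) _.
apply: le_lt_trans (_ : e / 2 < e); last by rewrite ltr_pdivrMr// mulr2n; lra.
have <- : e / 2 * \sum_(c <- s n) phi n c x = e / 2 by rewrite sum1 mulr1.
rewrite mulr_sumr; apply: ler_sum => c _.
have p0 : 0 <= phi n c x by rewrite divr_ge0// ltW.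
rewrite normrM (ger0_norm p0).
(* Near centres are handled by uniform continuity; at far ones the tent vanishes. *)
have [lt|ge] := ltP (d c x) n.+1%:R^-1.
  rewrite ler_wpM2r// ltW// distrC; apply: hr; exact: lt_trans nr.
by rewrite /phi /hat max_l ?subr_le0// mul0r !mulr0.
Qed.

(** Rescaling the residuals by positive constants gives the geometric bound and preserves both the
    span and the triangular shape. The summand 1 in the denominator covers zero residuals. *)
Lemma triangular_dense_sequence : exists e : nat -> X -> R,
  [/\ forall m, continuous (e m),
      forall m x, `|e m x| <= 2^-1 ^+ m.+1,
      forall m, e m = 0 \/
        exists2 t, e m t != 0 & forall j, (m < j)%N -> e j t = 0 &
      forall f, continuous f -> forall eps : R, 0 < eps ->
        exists2 h, in_span e h & forall x, `|f x - h x| < eps].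
Proof.
have [g [cg dg]] := dense_sequence.
have cr m : continuous (residual g m) by exact: eliminate_continuous.
pose c m := 2^-1 ^+ m.+1 / (1 + sup_norm (residual g m)).
have h0 m : 0 < 2^-1 ^+ m.+1 :> R by rewrite exprn_gt0// invr_gt0.
(* A point is supplied because the sign of [sup_norm] is read off from a value of the function. *)
have sup0 (x : X) m : 0 < 1 + sup_norm (residual g m).
  apply: ltr_pwDl => //; apply: le_trans (compact_sup_norm_ge X_compact x (cr m)).
  exact: normr_ge0.
have c0 (x : X) m : 0 < c m by rewrite divr_gt0 ?(sup0 x).
exists (fun m => c m *: residual g m); split.
- by move=> m x; apply: cvgM; [exact: cvg_cst|exact: cr].
- move=> m x; rewrite !fctE normrM (gtr0_norm (c0 x m)) /c.
  rewrite -mulrA ler_piMr ?(ltW (h0 _))// mulrC ler_pdivrMr ?(sup0 x)// mul1r.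
  apply: le_trans (compact_sup_norm_ge X_compact x (cr m)) _; lra.
- move=> m; have [->|[t rt h]] := residual_triangular g m.
    by left; rewrite scaler0.
  right; exists t; first by rewrite !fctE mulf_neq0// gt_eqF// (c0 t).
  by move=> j mj; rewrite !fctE h// scaler0.
- move=> f cf eps eps0; have [h hg fh] := dg f cf eps eps0; exists h => //.
  apply: in_span_trans hg => m; apply: in_span_trans (residual_span g m) => j.
  have -> : residual g j = (c j)^-1 *: (c j *: residual g j) + 0.
    apply/funext => x; rewrite addr0 scalerA mulVf ?scale1r//.
    by rewrite gt_eqF// (c0 x).
  by apply: (in_spanD (c j)^-1 j); exact: in_span0.
Qed.

End DenseSequence.

(** * Integrals of continuous functions *)

Section BorelIntegrals.
Variables (R : realType) (X : topologicalType) (x0 : X).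
Hypothesis X_compact : compact [set: X].

Lemma continuous_borel_measurable (f : X -> R) : continuous f ->
  measurable_fun setT (f : borel x0 -> R).
Proof.
move=> /continuousP cf; apply: (measurability _ (RGenOpens.measurableE R)).
move=> _ [_ [a [b ->] <-]]; rewrite setTI; apply: open_borel_measurable.
exact/cf/interval_open.
Qed.

Lemma continuous_borel_integrable (P : probability (borel x0) R) (f : X -> R) :
  continuous f -> P.-integrable setT (EFin \o (f : borel x0 -> R)).
Proof.
move=> cf; apply: measurable_bounded_integrable => //.
- by rewrite [X in (X < _)%E]probability_setT ltry.
- exact: continuous_borel_measurable.
- exists (sup_norm f); split; first exact: num_real.
  move=> M /ltW lt x _; apply: le_trans lt; exact: compact_sup_norm_ge.
Qed.

Lemma norm_integral_le (P : probability (borel x0) R) (f : X -> R) (C : R) :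
  continuous f -> (forall x, `|f x| <= C) ->
  `|\int[P]_(x in setT) (f : borel x0 -> R) x| <= C.
Proof.
move=> cf fC; have iP := continuous_borel_integrable P cf.
apply: le_trans (le_normr_Rintegral measurableT iP) _.
have cn : continuous (fun x => `|f x|).
  by move=> x; apply: continuous_comp; [exact: cf|exact: norm_continuous].
apply: (@le_trans _ _ (\int[P]_(x in setT) C)).
  apply: le_Rintegral => //; first exact: continuous_borel_integrable cn.
  exact: finite_measure_integrable_cst.
by rewrite Rintegral_cst// [X in _ * fine X]probability_setT mulr1.
Qed.

Hypothesis X_hausdorff : hausdorff_space X.
Variables (d : X -> X -> R).
Hypotheses (d_metric : is_metric d) (d_gen : generates_topology d).

(** For compact [K] inside [U], a Urysohn function lies between the indicators of [K] and [U], so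
    its common integral lies between [P K] and [Q U]; inner regularity of [P] concludes. *)
Let open_le (P Q : probability (borel x0) R) :
  (forall f : X -> R, continuous f ->
    \int[P]_(x in setT) (f : borel x0 -> R) x =
    \int[Q]_(x in setT) (f : borel x0 -> R) x) ->
  forall U : set X, open U ->
  (P (U : set (borel x0)) <= Q (U : set (borel x0)))%E.
Proof.
move=> PQ U oU; have mU := open_borel_measurable (x0 := x0) oU.
have [PU _] := compact_metric_radon d_metric d_gen P X_compact X_hausdorff mU.
rewrite [leLHS]PU.
apply: ge_ereal_sup => _ [K [cK KU] <-].
have clK := compact_closed X_hausdorff cK.
have mK := closed_borel_measurable (x0 := x0) clK.
have UK0 : ~` U `&` K = set0.
  by apply/seteqP; split=> // x [nU /KU].
have [f [cf f01 fU fK]] := @urysohn_compact_hausdorff R X X_compact X_hausdorff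
  (~` U) K (open_closedC oU) clK UK0.
have mf := continuous_borel_measurable cf.
have f0 (x : borel x0) : (0 <= (f x)%:E)%E by rewrite lee_fin; case/andP: (f01 x).
have PQE : (\int[P]_(x in setT) (f x)%:E = \int[Q]_(x in setT) (f x)%:E)%E.
  have iP := integrable_fin_num measurableT (continuous_borel_integrable P cf).
  have iQ := integrable_fin_num measurableT (continuous_borel_integrable Q cf).
  by rewrite -(fineK iP) -(fineK iQ); congr EFin; exact: PQ.
have PK : (P (K : set (borel x0)) <= \int[P]_(x in setT) (f x)%:E)%E.
  have PKE : P (K : set (borel x0)) =
      (\int[P]_(x in setT) (\1_(K : set (borel x0)) x)%:E)%E.
    by rewrite integral_indic// setIT.
  rewrite [leLHS]PKE.
  apply: ge0_le_integral => //.
  - exact/measurable_EFinP.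
  - exact/measurable_EFinP.
  - move=> x _; rewrite lee_fin indicE; case: (boolP (x \in _)) => [/set_mem/fK->//|_].
    by have := f0 x; rewrite lee_fin.
apply: le_trans PK _; rewrite PQE.
have QUE : Q (U : set (borel x0)) =
    (\int[Q]_(x in setT) (\1_(U : set (borel x0)) x)%:E)%E.
  by rewrite integral_indic// setIT.
rewrite [leRHS]QUE.
apply: ge0_le_integral => //.
- exact/measurable_EFinP.
- exact/measurable_EFinP.
- move=> x _; rewrite lee_fin indicE; case: (boolP (x \in _)) => [_|/negP nU].
    by case/andP: (f01 x).
  by rewrite fU// => Ux; apply: nU; rewrite inE.
Qed.

(** By symmetry [P] and [Q] agree on open sets, and outer regularity extends this to Borel sets. *)
Lemma integrals_determine_probability (P Q : probability (borel x0) R) :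
  (forall f : X -> R, continuous f ->
    \int[P]_(x in setT) (f : borel x0 -> R) x =
    \int[Q]_(x in setT) (f : borel x0 -> R) x) ->
  forall A : set (borel x0), measurable A -> P A = Q A.
Proof.
move=> PQ A mA.
have [_ PA] := compact_metric_radon d_metric d_gen P X_compact X_hausdorff mA.
have [_ QA] := compact_metric_radon d_metric d_gen Q X_compact X_hausdorff mA.
rewrite [LHS]PA [RHS]QA.
congr ereal_inf; apply/seteqP; split=> _ [U [oU AU] <-]; exists U => //;
  by apply/eqP; rewrite eq_le !open_le// => f cf; rewrite PQ.
Qed.

End BorelIntegrals.

(** * The kernel of a triangular sequence *)

Section HalfSeries.
Variable R : realType.
Implicit Types u : nat -> R.

Lemma cvg_half_series u (C : R) :
  (forall m, `|u m| <= C * 2^-1 ^+ m.+1) -> cvgn (series u).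
Proof.
move=> hu; apply: (@cvg_series_dominated _ _ (geometric (C / 2) 2^-1)).
  by move=> m; rewrite /geometric /=; apply: le_trans (hu m) _; rewrite exprS mulrA.
by apply: is_cvg_geometric_series; rewrite ger0_norm ?invr_ge0// invf_lt1// ltr1n.
Qed.

Lemma half_series_tail u (C : R) N :
  (forall m, `|u m| <= C * 2^-1 ^+ m.+1) ->
  `|limn (series u) - \sum_(0 <= m < N) u m| <= C * 2^-1 ^+ N.
Proof.
move=> hu; have cu := cvg_half_series hu.
have C0 : 0 <= C.
  by have := le_trans (normr_ge0 _) (hu 0%N); rewrite pmulr_lge0// exprn_gt0// invr_gt0.
have ct : (fun n => `|series u n - \sum_(0 <= m < N) u m|) @ \oo -->
    `|limn (series u) - \sum_(0 <= m < N) u m|.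
  by apply: cvg_norm; apply: cvgB => //; exact: cvg_cst.
rewrite -(cvg_lim _ ct)//; apply: limr_le; first by apply/cvg_ex; eexists; exact: ct.
exists N => // n /= Nn; rewrite /series /= (big_cat_nat (leq0n N) Nn) /=.
rewrite addrAC subrr add0r; apply: le_trans (ler_norm_sum _ _ _) _.
(* For ratio 1/2 each geometric term is the difference of two consecutive powers, so the sum
   telescopes. *)
apply: (@le_trans _ _ (\sum_(N <= m < n) - (C * 2^-1 ^+ m.+1 - C * 2^-1 ^+ m))).
  apply: ler_sum => m _; apply: le_trans (hu m) _.
  rewrite opprB exprS; have : 0 <= 2^-1 ^+ m :> R by rewrite exprn_ge0// invr_ge0.
  by move: (2^-1 ^+ m) => h h0; nra.
rewrite sumrN (telescope_sumr (fun m => C * 2^-1 ^+ m))// opprB.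
by rewrite lerBlDr lerDl mulr_ge0// exprn_ge0// invr_ge0.
Qed.

Lemma half_expr_lt (C e : R) : 0 < e -> exists N : nat, C * 2^-1 ^+ N < e.
Proof.
move=> e0.
have h : (fun N : nat => C * 2^-1 ^+ N) @ \oo --> C * 0.
  apply: cvgM; first exact: cvg_cst.
  by apply: cvg_expr; rewrite ger0_norm ?invr_ge0// invf_lt1// ltr1n.
have /cvgrPdist_lt/(_ e e0)[N _ /(_ N (leqnn N))] := h.
rewrite mulr0 sub0r normrN => lt; exists N; exact: le_lt_trans (ler_norm _) lt.
Qed.

(** Weierstrass test: the partial sums are continuous and converge uniformly. *)
Lemma continuous_half_series (Y : topologicalType) (f : nat -> Y -> R) (C : R) :
  (forall m, continuous (f m)) -> (forall m y, `|f m y| <= C * 2^-1 ^+ m.+1) ->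
  continuous (fun y => limn (series (f ^~ y))).
Proof.
move=> cf hf y; apply/cvgrPdist_lt => e e0.
have e30 : 0 < e / 3 by rewrite divr_gt0.
have [N hN] := half_expr_lt C e30.
have cS : continuous (fun z => \sum_(0 <= m < N) f m z).
  move=> z; apply: cvg_big => [|m _]; first exact: add_continuous.
  exact: cf.
have /cvgrPdist_lt/(_ _ e30) := cS y; apply: filterS => z.
have := half_series_tail N (hf ^~ y); have := half_series_tail N (hf ^~ z).
set lz := limn (series (f ^~ z)); set ly := limn (series (f ^~ y)).
move: (\sum_(0 <= m < N) f m z) (\sum_(0 <= m < N) f m y) => sz sy h1 h2 h3.
have -> : ly - lz = (ly - sy) + (sy - sz) - (lz - sz) by ring.
apply: le_lt_trans (ler_normB _ _) _.
have := ler_normD (ly - sy) (sy - sz); lra.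
Qed.

End HalfSeries.

Lemma dot_suml (R : realType) (I : Type) (s : seq I) (c : I -> R)
    (u : I -> nat -> R) (v : nat -> R) :
  (forall i, square_summable (u i)) -> square_summable v ->
  square_summable (fun n => \sum_(i <- s) c i * u i n) /\
  dot (fun n => \sum_(i <- s) c i * u i n) v = \sum_(i <- s) c i * dot (u i) v.
Proof.
move=> hu hv; elim: s => [|i s [ih1 ih2]].
  have -> : (fun n => \sum_(i <- [::]) c i * u i n) = fun=> 0.
    by apply/funext => n; rewrite big_nil.
  split; first exact: square_summable0.
  by rewrite big_nil (@dot_finite _ _ _ 0%N)// big_geq.
have -> : (fun n => \sum_(j <- i :: s) c j * u j n) =
    fun n => c i * u i n + \sum_(j <- s) c j * u j n.
  by apply/funext => n; rewrite big_cons.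
split; first exact: square_summable_lin.
by rewrite dot_linl// big_cons ih2.
Qed.

Lemma sum_half_le1 (R : realType) n : \sum_(0 <= m < n) 2^-1 ^+ m.+1 <= 1 :> R.
Proof.
have -> : \sum_(0 <= m < n) 2^-1 ^+ m.+1 = 1 - 2^-1 ^+ n :> R.
  elim: n => [|n ih]; first by rewrite big_geq// expr0 subrr.
  rewrite big_nat_recr //= ih exprS; move: (2^-1 ^+ n) => h; lra.
by rewrite gerBl exprn_ge0// invr_ge0.
Qed.

(** * Hilbert space, kernel and mean embedding of a triangular family *)

Section TriangularFamily.
Variables (R : realType) (X : topologicalType) (e : nat -> X -> R).
Hypothesis e_cont : forall m, continuous (e m).
Hypothesis e_bound : forall m x, `|e m x| <= 2^-1 ^+ m.+1.
Hypothesis e_tri : forall m, e m = 0 \/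
  exists2 t, e m t != 0 & forall j, (m < j)%N -> e j t = 0.

(** Coefficients of zero members are forced to vanish, since the function represented could not
    determine them. *)
Definition admissible (a : nat -> R) :=
  square_summable a /\ forall m, e m = 0 -> a m = 0.

Definition comb (a : nat -> R) (x : X) := dot a (e ^~ x).

Lemma family_square_summable x : square_summable (e ^~ x).
Proof.
apply: (@cvg_half_series _ _ 1) => m; rewrite normrX mul1r.
have := e_bound m x; have : 2^-1 ^+ m.+1 <= 1 :> R.
  by rewrite exprn_ile1 ?invr_ge0// invf_le1// ler1n.
have := normr_ge0 (e m x); move: `|_| (2^-1 ^+ _) => s t; nra.
Qed.

Lemma family_admissible x : admissible (e ^~ x).
Proof. by split=> [|m ->//]; exact: family_square_summable. Qed.

Lemma admissible_lin c a b : admissible a -> admissible b ->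
  admissible (fun n => c * a n + b n).
Proof.
move=> [ha a0] [hb b0]; split; first exact: square_summable_lin.
by move=> m em; rewrite a0// b0// mulr0 addr0.
Qed.

Lemma admissible0 : admissible (fun=> 0).
Proof. by split=> //; exact: square_summable0. Qed.

Lemma comb_lin c a b : admissible a -> admissible b ->
  comb (fun n => c * a n + b n) = c *: comb a + comb b.
Proof.
move=> [ha _] [hb _]; apply/funext => x; rewrite /comb dot_linl//.
exact: family_square_summable.
Qed.

(** At the pivot of [e m] the series stops after index [m]; earlier coefficients vanish by
    induction, which leaves [a m] times a nonzero value. *)
Lemma comb_eq0 a : admissible a -> comb a = 0 -> a = fun=> 0.
Proof.
move=> [ha a0] c0; apply/funext => m; elim/ltn_ind: m => m ih.
have [/a0//|[t et h]] := e_tri m.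
have : comb a t = 0 by rewrite c0.
rewrite /comb dotC (@dot_finite _ _ _ m.+1); last by move=> j; exact: h.
rewrite big_nat_recr //= big_nat big1 ?add0r; last by move=> j /andP[_ /ih->]; rewrite mulr0.
by move=> /eqP; rewrite mulf_eq0 (negbTE et) => /eqP.
Qed.

Lemma comb_inj a b : admissible a -> admissible b -> comb a = comb b -> a = b.
Proof.
move=> ha hb ab; have := comb_eq0 (admissible_lin (-1) hb ha) _.
rewrite comb_lin// ab scaleN1r addNr => /(_ erefl) h; apply/funext => n.
by have /(congr1 (@^~ n)) := h; rewrite /= mulN1r => /eqP; rewrite addrC subr_eq0 => /eqP.
Qed.

Definition family_space := [set h | exists2 a, admissible a & h = comb a].

(** On [family_space] the coefficients are unique; the default 0 is taken only outside it. *)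
Definition coef (h : X -> R) : nat -> R :=
  xget (fun=> 0) [set a | admissible a /\ h = comb a].

Lemma coef_comb a : admissible a -> coef (comb a) = a.
Proof.
move=> ha; rewrite /coef; case: xgetP => [b _ [hb ab]|/(_ a)]; last by case.
exact/esym/comb_inj.
Qed.

Definition family_ip (f g : X -> R) := dot (coef f) (coef g).

(** With this order of arguments, [family_kernel ^~ x] is [comb (e ^~ x)] by definition. *)
Definition family_kernel (x y : X) : R := dot (e ^~ y) (e ^~ x).

Lemma family_ip_comb a b : admissible a -> admissible b ->
  family_ip (comb a) (comb b) = dot a b.
Proof. by move=> ha hb; rewrite /family_ip !coef_comb. Qed.

Lemma combB a b : admissible a -> admissible b ->
  comb a - comb b = comb (fun n => a n - b n) /\ admissible (fun n => a n - b n).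
Proof.
move=> ha hb; have -> : (fun n => a n - b n) = fun n => -1 * b n + a n.
  by apply/funext => n; rewrite mulN1r addrC.
by rewrite comb_lin// scaleN1r addrC; split=> //; exact: admissible_lin.
Qed.

(** The structure is carried over from the admissible sequences, a closed subspace of the
    square-summable ones. *)
Lemma family_hilbert : hilbert_function_space family_space family_ip.
Proof.
split.
- exists (fun=> 0); first exact: admissible0.
  by apply/funext => x; rewrite /comb (@dot_finite _ _ _ 0%N)// big_geq.
- move=> c _ _ [a ha ->] [b hb ->]; rewrite -comb_lin//.
  by eexists; last reflexivity; exact: admissible_lin.
- by move=> f g _ _; exact: dotC.
- move=> c _ _ _ [a ha ->] [b hb ->] [a' ha' ->].
  rewrite -comb_lin// !family_ip_comb//; last exact: admissible_lin.
  by rewrite dot_linl; [|case: ha|case: hb|case: ha'].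
- by move=> _ [a ha ->]; rewrite family_ip_comb//; apply: dot_ge0; case: ha.
- move=> _ [a ha ->]; rewrite family_ip_comb// => /dot_eq0 -> //; last by case: ha.
  by apply/funext => x; rewrite /comb (@dot_finite _ _ _ 0%N)// big_geq.
- move=> u hu cauchy.
  have hu' n : exists a, admissible a /\ u n = comb a by have [a] := hu n; exists a.
  pose a n := sval (cid (hu' n)).
  have ha n : admissible (a n) by have [] := svalP (cid (hu' n)).
  have ua n : u n = comb (a n) by have [] := svalP (cid (hu' n)).
  have [||b [hb cb bl]] := @l2_complete R a.
  + by move=> n; case: (ha n).
  + move=> eps /cauchy[N hN]; exists N => m n Nm Nn; have := hN m n Nm Nn.
    rewrite !ua; have [-> hB] := combB (ha m) (ha n).
    by rewrite family_ip_comb.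
  + have hb' : admissible b.
      (* The zero constraint survives coordinatewise limits. *)
      split=> // m em; apply/esym/(@cvg_unique _ (@Rhausdorff R) (a ^~ m @ \oo)).
        rewrite (_ : a ^~ m = fun=> 0); first exact: cvg_cst.
        by apply/funext => n; case: (ha n) => _ ->.
      exact: cb.
    exists (comb b); first by exists b.
    move=> eps /bl[N hN]; exists N => n Nn; rewrite ua.
    have [-> hB] := combB (ha n) hb'; rewrite family_ip_comb//; exact: hN.
Qed.

Lemma family_rkhs : is_rkhs family_kernel family_space family_ip.
Proof.
split; first exact: family_hilbert.
- by move=> x; exists (e ^~ x) => //; exact: family_admissible.
- move=> _ x [a ha ->]; rewrite (_ : family_kernel ^~ x = comb (e ^~ x))//.
  by rewrite family_ip_comb//; exact: family_admissible.
Qed.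

(** The quadratic form is the squared norm of the combination of the sequences [e ^~ (x i)] with
    weights [a i]. *)
Lemma family_is_kernel : is_kernel family_kernel.
Proof.
split=> [x y|n a x]; first exact: dotC.
pose s := index_enum 'I_n.
have hx i : square_summable (e ^~ (x i)) by exact: family_square_summable.
have [hv _] := dot_suml s a hx (@square_summable0 R).
have [_ vE] := dot_suml s a hx hv.
have := dot_ge0 hv; rewrite vE; congr (0 <= _); apply: eq_bigr => i _.
have [_] := dot_suml s a hx (hx i); rewrite dotC => ->; rewrite mulr_sumr.
by apply: eq_bigr => j _; rewrite mulrA.
Qed.

Lemma abs_dot_family_term a m x : admissible a ->
  `|a m * e m x| <= Num.sqrt (dot a a) * 2^-1 ^+ m.+1.
Proof.
move=> [ha _]; rewrite normrM ler_pM// -sqrtr_sqr ler_wsqrtr//.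
exact: sqr_le_dot.
Qed.

Lemma comb_continuous a : admissible a -> continuous (comb a).
Proof.
move=> ha; apply: continuous_half_series => [m|m x]; last exact: abs_dot_family_term.
by move=> x; apply: cvgM; [exact: cvg_cst|exact: e_cont].
Qed.

Lemma abs_family_kernel_term m x y : `|e m y * e m x| <= 1 * 2^-1 ^+ m.+1.
Proof.
rewrite normrM ler_pM//; apply: le_trans (e_bound m y) _.
by rewrite exprn_ile1 ?invr_ge0// invf_le1// ler1n.
Qed.

Lemma family_kernel_continuous : continuous_kernel family_kernel.
Proof.
apply: (@continuous_half_series _ _ (fun m (z : X * X) => e m z.2 * e m z.1) 1).
  move=> m z; apply: cvgM; apply: continuous_comp; try exact: e_cont.
    exact: cvg_snd.
  exact: cvg_fst.
by move=> m z; exact: abs_family_kernel_term.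
Qed.

Lemma family_kernel_bounded x y : `|family_kernel x y| <= 1.
Proof.
have := half_series_tail 0 (fun m => abs_family_kernel_term m x y).
by rewrite big_geq// subr0 expr0 mulr1.
Qed.

Definition delta (m n : nat) : R := (n == m)%:R.

Lemma square_summable_delta m : square_summable (delta m).
Proof.
by apply: (@finite_square_summable _ _ m.+1) => n mn; rewrite /delta gtn_eqF.
Qed.

Lemma dot_delta m a : dot (delta m) a = a m.
Proof.
rewrite (@dot_finite _ _ _ m.+1); last by move=> n mn; rewrite /delta gtn_eqF.
rewrite big_nat_recr //= big_nat big1 ?add0r /delta ?eqxx ?mul1r//.
by move=> i /andP[_ im]; rewrite ltn_eqF// mul0r.
Qed.

Lemma comb_delta m : comb (delta m) = e m.
Proof. by apply/funext => x; exact: dot_delta. Qed.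

(** The unit sequence [delta m] is not admissible when [e m = 0]; the zero sequence then represents
    [e m]. The norm bound gives a bound on functionals uniform in [m]. *)
Lemma family_mem m : exists a, [/\ admissible a, e m = comb a & dot a a <= 1].
Proof.
have [em0|em0] := eqVneq (e m) 0.
  exists (fun=> 0); split; first exact: admissible0.
    by rewrite em0; apply/funext => x; rewrite /comb (@dot_finite _ _ _ 0%N)// big_geq.
  by rewrite (@dot_finite _ _ _ 0%N)// big_geq.
exists (delta m); split; last by rewrite dot_delta /delta eqxx.
  split; first exact: square_summable_delta.
  by move=> n en; rewrite /delta; case: eqP => // nm; rewrite -nm en eqxx in em0.
by rewrite comb_delta.
Qed.

Lemma in_span_family_space h : in_span e h -> family_space h.
Proof.
elim=> [|a m {}h _ Hh]; first exact: (hfs_zero family_hilbert).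
apply: (hfs_lin family_hilbert) => //.
by have [b [hb eb _]] := family_mem m; exists b.
Qed.

Hypothesis e_dense : forall f, continuous f -> forall eps : R, 0 < eps ->
  exists2 h, in_span e h & forall x, `|f x - h x| < eps.

Lemma family_universal : universal family_kernel.
Proof.
split; first exact: family_kernel_continuous.
exists family_space, family_ip; split; first exact: family_rkhs.
  by move=> _ [a ha ->]; exact: comb_continuous.
move=> f cf eps eps0; have eps20 : 0 < eps / 2 by rewrite divr_gt0.
have [h hs hf] := e_dense cf eps20; exists h; first exact: in_span_family_space.
apply: le_lt_trans (_ : eps / 2 < eps); last by rewrite ltr_pdivrMr// mulr2n; lra.
(* The least upper bound property needs a nonempty range; on the empty space [sup_norm] is 0. *)
have [[x _]|nX] := pselect (exists x : X, True).
  apply: ge_sup; first by exists `|(f - h) x|, x.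
  by move=> _ [y _ <-]; exact/ltW/hf.
rewrite /sup_norm (_ : [set _ | _ in _] = set0) ?sup0 ?ltW//.
by apply/seteqP; split=> // y [x _ _]; case: nX; exists x.
Qed.

(** By linearity the remainder after [n] terms is the value of [phi] at the tail of [a], whose norm
    tends to 0. *)
Lemma functional_comb phi a :
  bounded_linear_functional family_space family_ip phi -> admissible a ->
  series (fun m => a m * phi (e m)) @ \oo --> phi (comb a).
Proof.
move=> [lin [C hC]] [ha a0].
pose tail n i := if (i < n)%N then 0 else a i.
have htail n : square_summable (tail n).
  have hh : square_summable (fun i => if (i < n)%N then a i else 0).
    by apply: (@finite_square_summable _ _ n) => i; rewrite leqNgt => /negbTE ->.
  have := square_summableB ha hh.
  by congr square_summable; apply/funext => i; rewrite /tail; case: ifP; rewrite ?subrr ?subr0.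
have atail n : admissible (tail n).
  by split=> // m /a0; rewrite /tail; case: ifP.
have stail n : family_space (comb (tail n)) by exists (tail n).
have phiE n : phi (comb a) = series (fun m => a m * phi (e m)) n + phi (comb (tail n)).
  elim: n => [|n ih]; first by rewrite /series /= big_geq// add0r.
  rewrite ih /series /= big_nat_recr //= -addrA; congr (_ + _).
  rewrite -lin//; last first.
    by have [b [hb eb _]] := family_mem n; exists b.
  congr phi; apply/funext => x.
  (* As [delta n] may fail to be admissible, the first term is split off inside [dot] and not by
     [comb_lin]. *)
  have -> : comb (tail n) x = dot (fun i => a n * delta n i + tail n.+1 i) (e ^~ x).
    congr dot; apply/funext => i; rewrite /tail /delta ltnS.
    by case: (ltngtP i n) => [||->]; rewrite ?mulr0 ?mulr1 ?add0r ?addr0.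
  rewrite dot_linl//; [|exact: square_summable_delta|exact: family_square_summable].
  by rewrite dot_delta.
apply/cvgrPdist_lt => eps eps0.
(* The constant [C] may be zero or negative, so a positive majorant is used for the division. *)
have C1 : 0 < `|C| + 1 by rewrite ltr_wpDl.
have e'0 : 0 < (eps / (`|C| + 1)) ^+ 2 by rewrite exprn_gt0// divr_gt0.
have [N hN] := dot_truncation ha e'0; exists N => // n /= /hN lt.
rewrite (phiE n) addrAC subrr add0r; apply: le_lt_trans (hC _ (stail n)) _.
rewrite family_ip_comb//.
have {lt} : Num.sqrt (dot (tail n) (tail n)) < eps / (`|C| + 1).
  by rewrite -[ltRHS]gtr0_norm ?divr_gt0// -sqrtr_sqr ltr_sqrt.
rewrite ltr_pdivlMr// mulrC; apply: le_lt_trans.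
rewrite ler_wpM2r ?sqrtr_ge0//; have := ler_norm C; lra.
Qed.

Lemma functional_family_bounded phi :
  bounded_linear_functional family_space family_ip phi ->
  exists2 C, 0 <= C & forall m, `|phi (e m)| <= C.
Proof.
move=> [_ [C hC]]; exists `|C| => // m.
have [a [ha -> a1]] := family_mem m.
have Ha : family_space (comb a) by exists a.
apply: le_trans (hC _ Ha) _; rewrite family_ip_comb//.
apply: (@le_trans _ _ (`|C| * Num.sqrt (dot a a))).
  by rewrite ler_wpM2r ?sqrtr_ge0// ler_norm.
rewrite ler_piMr// -[leRHS]sqrtr1; exact: ler_wsqrtr.
Qed.

Hypothesis X_compact : compact [set: X].
Variable x0 : X.

Definition family_mean (P : probability (borel x0) R) (m : nat) : R :=
  \int[P]_(x in setT) (e m : borel x0 -> R) x.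

Lemma family_mean_bound P m : `|family_mean P m| <= 2^-1 ^+ m.+1.
Proof. exact: norm_integral_le. Qed.

Lemma family_mean_admissible P : admissible (family_mean P).
Proof.
split=> [|m em]; last first.
  by rewrite /family_mean em /Rintegral integral0_eq.
apply: (@cvg_half_series _ _ 1) => m; rewrite normrX mul1r.
have := family_mean_bound P m; have : 2^-1 ^+ m.+1 <= 1 :> R.
  by rewrite exprn_ile1 ?invr_ge0// invf_le1// ler1n.
have := normr_ge0 (family_mean P m); move: `|_| (2^-1 ^+ _) => s t; nra.
Qed.

(** Applied to the feature of [x], [phi] gives the series of [e m x * phi (e m)], whose partial sums
    are bounded by a constant. Dominated convergence integrates it term by term, and the result is
    the series of [phi] at the mean. *)
Lemma family_pettis (P : probability (borel x0) R) :
  is_pettis_integral family_space family_ip P (fun x => family_kernel ^~ x)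
    (comb (family_mean P)).
Proof.
have hm := family_mean_admissible P.
split; first by exists (family_mean P).
move=> phi hphi; have [C C0 hC] := functional_family_bounded hphi.
pose S n (x : borel x0) : R := \sum_(0 <= m < n) e m x * phi (e m).
have S_cont n : continuous (S n : X -> R).
  move=> x; apply: cvg_big => [|m _]; first exact: add_continuous.
  by apply: cvgM; [exact: e_cont|exact: cvg_cst].
have mS n : measurable_fun setT (fun x => (S n x)%:E).
  by apply/measurable_EFinP; exact: continuous_borel_measurable.
have S_cvg (x : borel x0) : (fun n => (S n x)%:E) @ \oo --> (phi (family_kernel ^~ x))%:E.
  apply: cvg_EFin; first exact: nearW.
  exact: (functional_comb hphi (family_admissible x)).
have mphi : measurable_fun setT (fun x : borel x0 => (phi (family_kernel ^~ x))%:E).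
  by apply: (emeasurable_fun_cvg (fun n x => (S n x)%:E)) => // x _; exact: S_cvg.
have S_bound n x : (`|(S n x)%:E| <= C%:E)%E.
  rewrite lee_fin; apply: le_trans (ler_norm_sum _ _ _) _.
  apply: (@le_trans _ _ (\sum_(0 <= m < n) 2^-1 ^+ m.+1 * C)).
    by apply: ler_sum => m _; rewrite normrM ler_pM.
  by rewrite -mulr_suml ler_piMl// sum_half_le1.
have [int_phi _ cvg_int] := dominated_convergence measurableT mS mphi
  (aeW _ (fun x _ => S_cvg x))
  (finite_measure_integrable_cst P C measurableT)
  (aeW _ (fun x n _ => S_bound n x)).
(* Both sides are limits of the integrals of the partial sums [S n]. *)
split=> //; apply: (cvg_unique _ cvg_int) => //.
rewrite (_ : [sequence _]_n =
    fun n => (series (fun m => family_mean P m * phi (e m)) n)%:E).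
  by apply: cvg_EFin; [exact: nearW|exact: functional_comb].
apply/funext => n; rewrite /S /series /=.
have im m : P.-integrable setT (fun x : borel x0 => (e m x)%:E).
  exact: (continuous_borel_integrable X_compact _ (@e_cont m)).
have iZ m : P.-integrable setT (fun x : borel x0 => ((phi (e m))%:E * (e m x)%:E)%E).
  exact: integrableZl.
under eq_integral => x _.
  rewrite -sumEFin; under eq_bigr => m _ do rewrite mulrC EFinM.
  over.
rewrite integral_sum// -sumEFin; apply: eq_bigr => m _.
rewrite integralZl// mulrC EFinM /family_mean /Rintegral fineK//.
exact: integrable_fin_num.
Qed.

(** The sigma-algebra is the product of the Borel ones, so measurability is derived from a pointwise
    limit of sums of products of one-variable functions. *)
Lemma family_kernel_measurable : measurable_fun setT
  (fun z : borel x0 * borel x0 => family_kernel z.1 z.2).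
Proof.
apply/measurable_EFinP.
apply: (emeasurable_fun_cvg (fun n (z : borel x0 * borel x0) =>
  (\sum_(0 <= m < n) e m z.2 * e m z.1)%:E)).
  move=> n; apply/measurable_EFinP; apply: measurable_sum => m.
  have me : measurable_fun setT (e m : borel x0 -> R).
    exact: continuous_borel_measurable.
  by apply: measurable_funM; apply: measurableT_comp.
move=> z _; apply: cvg_EFin; first exact: nearW.
apply: (@cvg_dot _ (e ^~ z.2) (e ^~ z.1)); exact: family_square_summable.
Qed.

Hypothesis X_hausdorff : hausdorff_space X.
Variable d : X -> X -> R.
Hypotheses (d_metric : is_metric d) (d_gen : generates_topology d).

(** Equal means give equal integrals on the span of the family, then by uniform density for every
    continuous function, and these integrals determine the measure. *)
Lemma family_mean_inj (P Q : probability (borel x0) R) :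
  family_mean P = family_mean Q ->
  forall A : set (borel x0), measurable A -> P A = Q A.
Proof.
move=> PQ; apply: (integrals_determine_probability X_compact X_hausdorff d_metric d_gen).
have span h : in_span e h -> continuous h /\
    \int[P]_(x in setT) (h : borel x0 -> R) x = \int[Q]_(x in setT) (h : borel x0 -> R) x.
  elim=> [|a m {}h _ [ch PQh]].
    by split; [move=> x; exact: cvg_cst|rewrite /Rintegral !integral0_eq].
  have cae : continuous (fun x => a * e m x).
    by move=> x; apply: cvgM; [exact: cvg_cst|exact: e_cont].
  split; first by move=> x; apply: cvgD; [exact: cae|exact: ch].
  have E (P' : probability (borel x0) R) :
      \int[P']_(x in setT) ((a *: e m + h : X -> R) : borel x0 -> R) x =
      a * family_mean P' m + \int[P']_(x in setT) (h : borel x0 -> R) x.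
    rewrite RintegralD//; last exact: (continuous_borel_integrable X_compact _ ch).
      rewrite RintegralZl//; exact: (continuous_borel_integrable X_compact _ (@e_cont m)).
    exact: (continuous_borel_integrable X_compact _ cae).
  by rewrite !E PQ PQh.
move=> f cf; apply/eqP; rewrite -subr_eq0 -normr_le0; apply/ler_addgt0Pr => eps eps0.
have eps20 : 0 < eps / 2 by rewrite divr_gt0.
have [h /span[ch PQh] fh] := e_dense cf eps20.
have cB : continuous (fun x => f x - h x).
  by move=> x; apply: cvgB; [exact: cf|exact: ch].
have E (P' : probability (borel x0) R) :
    `|\int[P']_(x in setT) (f : borel x0 -> R) x -
      \int[P']_(x in setT) (h : borel x0 -> R) x| <= eps / 2.
  rewrite -RintegralB//; [|exact: (continuous_borel_integrable X_compact _ cf)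
                          |exact: (continuous_borel_integrable X_compact _ ch)].
  by apply: norm_integral_le => // x; exact/ltW/fh.
have := E P; have := E Q; rewrite PQh add0r.
move: (Rintegral _ _ _) (Rintegral _ _ _) (Rintegral _ _ _) => u v w.
rewrite !ler_norml => /andP[? ?] /andP[? ?]; apply/andP; split; lra.
Qed.

Lemma family_characteristic : characteristic family_kernel x0.
Proof.
split.
- by exists 1; exact: family_kernel_bounded.
- exact: family_kernel_measurable.
exists family_space, family_ip, (fun P => comb (family_mean P)); split.
- exact: family_rkhs.
- exact: family_pettis.
move=> P Q /comb_inj PQ; apply: family_mean_inj; apply: PQ;
  exact: family_mean_admissible.
Qed.

End TriangularFamily.

(** One kernel serves both as universal and as characteristic kernel. *)
Lemma metrizable_kernel (R : realType) (X : topologicalType) :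
  compact [set: X] -> hausdorff_space X -> metrizable R X ->
  exists k : X -> X -> R, [/\ is_kernel k, universal k &
    forall x0 : X, characteristic k x0].
Proof.
move=> cX hX [d [d_metric d_gen]].
have [e [e_cont e_bound e_tri e_dense]] :=
  triangular_dense_sequence d_metric d_gen cX.
exists (family_kernel e); split.
- exact: family_is_kernel.
- exact: family_universal.
- by move=> x0; exact: family_characteristic d_metric d_gen.
Qed.

(** * Equivalence of the three statements and its consequences *)

Unset Implicit Arguments.

Theorem theorem3p15 (R : realType) (X : topologicalType)
    (X_compact : compact [set: X]) (X_hausdorff : hausdorff_space X) :
  let i := exists k : X -> X -> R, is_kernel k /\ universal k in
  let ii := exists k : X -> X -> R,
    [/\ is_kernel k, continuous_kernel k & forall x0 : X, characteristic k x0] in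
  let iii := metrizable R X in
  [/\ i <-> ii, ii <-> iii &
      i \/ ii \/ iii ->
      polish R X /\
      forall x0 : X, signed_radon_measures R x0 = signed_measures R x0].
Proof.
move=> i ii iii.
have i_iii : i -> iii by move=> [k [_ uk]]; exact: universal_metrizable uk.
have ii_iii : ii -> iii.
  by move=> [k [_ ck chk]]; exact: characteristic_metrizable chk.
have iii_i : iii -> i.
  by move=> /(metrizable_kernel X_compact X_hausdorff)[k [kk uk _]]; exists k.
have iii_ii : iii -> ii.
  by move=> /(metrizable_kernel X_compact X_hausdorff)[k [kk [ck _] chk]]; exists k.
split; first by split=> [/i_iii/iii_ii|/ii_iii/iii_i].
  by split=> [/ii_iii|/iii_ii].
move=> h; have [d [d_metric d_gen]] : iii by case: h => [/i_iii|[/ii_iii|]].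
split; first exact: compact_metric_polish d_metric d_gen X_compact.
by move=> x0; exact: signed_radon_measuresE d_metric d_gen X_compact X_hausdorff.
Qed.
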